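(* If $M\subseteq G$ and $M'\subseteq G'$ are coacyclic subsets of groups $G$ and $G'$, then $$M\vee M'\subseteq G\times G'\qquad\text{and}\qquad\iota(M)\cup\iota'(M')\subseteq G*G'$$ are coacyclic subsets, where $M\vee M'=(M\times1)\cup(1\times M')$, $G*G'$ is the free product and $\iota:G\to G*G'$, $\iota':G'\to G*G'$ are the canonical embeddings.
   Context: The coefficient ring is $\mathbb{Z}$. For a group $G$, $\mathsf{N}G$ is the normalized chain complex over $\mathbb{Z}$ of the nerve of $G$: $(\mathsf{N}G)_0=\mathbb{Z}$; $(\mathsf{N}G)_n$ is free on symbols $\langle g_1,\dots,g_n\rangle$ with $g_i\in G\setminus\{1\}$, a symbol with some $g_i=1$ being $0$; $\partial=\sum_{i=0}^n(-1)^i\tilde d_i$, where $\tilde d_0$ deletes $g_1$, $\tilde d_n$ deletes $g_n$, and $\tilde d_i$ ($1\le i\le n-1$) replaces $g_i,g_{i+1}$ by the product $g_{i+1}g_i$. Its homology is $H_*(G)$. For a pointed subset $M\subseteq G$ (a subset containing the unit), $(\mathsf{N}M)_0=\mathbb{Z}$ and $(\mathsf{N}M)_n\subseteq(\mathsf{N}G)_n$ is spanned by the symbols with all $g_i\in M$; $\Omega(G,M)$ is the subcomplex of $\mathsf{N}G$ with $\Omega_n(G,M)=(\mathsf{N}M)_n\cap\partial^{-1}((\mathsf{N}M)_{n-1})$; and $\mathsf{PH}_*(G,M)=H_*(\Omega(G,M))$. A pointed subset $M\subseteq G$ is coacyclic if the map $\mathsf{PH}_*(G,M)\to H_*(G)$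 induced by the inclusion $\Omega(G,M)\subseteq\mathsf{N}G$ is an isomorphism. *)

(* Defs.v *)
From HB Require Import structures.
From mathcomp Require Import all_boot all_algebra.
From mathcomp Require Import boolp classical_sets.
From mathcomp Require Import freeg zify.

Set Implicit Arguments.
Unset Strict Implicit.
Unset Printing Implicit Defensive.

Import GRing.Theory.

Local Open Scope ring_scope.
Local Open Scope quotient_scope.
Local Open Scope classical_set_scope.

Record chain_complex := ChainComplex {
  chain :> nat -> zmodType;
  bd : forall n, {additive chain n.+1 -> chain n};
  bdK : forall n (x : chain n.+2), bd n (bd n.+1 x) = 0
}.
Arguments bd C {n} : rename.

Section Homology.
Variables (C : chain_complex) (n : nat).

Definition is_cycle : {pred C n} :=
  match n return {pred C n} with
  | 0 => predT
  | m.+1 => [pred x : C m.+1 | bd C x == 0]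
  end.

Fact cycle_zmod_closed : zmod_closed is_cycle.
Proof.
rewrite /is_cycle; case: n => [|m]; split=> //=.
  by rewrite inE raddf0.
by move=> x y; rewrite !inE => /eqP dx /eqP dy; rewrite raddfB /= dx dy subrr.
Qed.
HB.instance Definition _ :=
  GRing.isZmodClosed.Build (C n) is_cycle cycle_zmod_closed.

Definition cycles := {x : C n | x \in is_cycle}.
HB.instance Definition _ := SubChoice.on cycles.
HB.instance Definition _ := [SubChoice_isSubZmodule of cycles by <:].

Definition is_boundary : {pred cycles} :=
  [pred z : cycles | `[< exists y : C n.+1, val z = bd C y >]].

Fact boundary_zmod_closed : zmod_closed is_boundary.
Proof.
split; first by apply/asboolP; exists 0; rewrite !raddf0.
move=> x y /asboolP[u xu] /asboolP[v yv].
by apply/asboolP; exists (u - v); rewrite !raddfB /= xu yv.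
Qed.
HB.instance Definition _ :=
  GRing.isZmodClosed.Build cycles is_boundary boundary_zmod_closed.

Definition homology := Quotient.quot is_boundary.
HB.instance Definition _ := GRing.Zmodule.on homology.
HB.instance Definition _ := EqQuotient.on homology.

End Homology.
Arguments is_cycle : clear implicits.
Arguments is_boundary : clear implicits.

Record chain_map (C D : chain_complex) := ChainMap {
  chain_fun :> forall n, {additive C n -> D n};
  chain_funD : forall n (x : C n.+1),
    chain_fun n (bd C x) = bd D (chain_fun n.+1 x)
}.

Section HomologyMap.
Variables (C D : chain_complex) (f : chain_map C D) (n : nat).

Fact cycle_fun_subproof (z : cycles C n) : f n (val z) \in is_cycle D n.
Proof.
case: n z => [|m] [z zP] //=; move: zP; rewrite !inE => /eqP dz.
by rewrite -chain_funD dz raddf0.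
Qed.

Definition cycle_fun (z : cycles C n) : cycles D n := 
  Sub (f n (val z)) (cycle_fun_subproof z).

Fact cycle_fun_is_additive : zmod_morphism cycle_fun.
Proof. by move=> x y; apply: val_inj; rewrite /= !raddfB. Qed.
HB.instance Definition _ :=
  GRing.isZmodMorphism.Build (cycles C n) (cycles D n) cycle_fun
    cycle_fun_is_additive.

Definition homology_fun (h : homology C n) : homology D n :=
  \pi_(homology D n) (cycle_fun (repr h)).

Lemma homology_funE (z : cycles C n) :
  homology_fun (\pi_(homology C n) z) = \pi_(homology D n) (cycle_fun z).
Proof.
apply/eqP; rewrite /homology_fun -Quotient.idealrBE -raddfB.
have : repr (\pi_(homology C n) z) - z \in is_boundary C n.
  by rewrite Quotient.idealrBE reprK.
move=> /asboolP[y yE]; apply/asboolP; exists (f n.+1 y).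
by rewrite -chain_funD -yE.
Qed.

Fact homology_fun_is_additive : zmod_morphism homology_fun.
Proof.
move=> x y; rewrite -[x]reprK -[y]reprK.
have piB E (u v : cycles E n) : \pi_(homology E n) u - \pi_(homology E n) v
    = \pi_(homology E n) (u - v).
  by rewrite -[in RHS]/(u + - v) Quotient.pi_add Quotient.pi_opp.
by rewrite piB !homology_funE piB raddfB.
Qed.
HB.instance Definition _ :=
  GRing.isZmodMorphism.Build (homology C n) (homology D n) homology_fun
    homology_fun_is_additive.

End HomologyMap.

Section Subcomplex.
Variables (C : chain_complex) (S : forall n, zmodClosed (C n)).
Hypothesis bdS : forall n (x : C n.+1), x \in S n.+1 -> bd C x \in S n.

Definition subchain n := {x : C n | x \in S n}.
HB.instance Definition _ n := SubChoice.on (subchain n).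
HB.instance Definition _ n := [SubChoice_isSubZmodule of subchain n by <:].

Definition subbd n (x : subchain n.+1) : subchain n :=
  Sub (bd C (val x)) (bdS (valP x)).

Fact subbd_is_additive n : zmod_morphism (@subbd n).
Proof. by move=> x y; apply: val_inj; rewrite /= !raddfB. Qed.
HB.instance Definition _ n :=
  GRing.isZmodMorphism.Build (subchain n.+1) (subchain n) (@subbd n)
    (@subbd_is_additive n).

Fact subbdK n (x : subchain n.+2) : subbd (subbd x) = 0.
Proof. by apply: val_inj; rewrite /= bdK. Qed.

Definition subcomplex : chain_complex :=
  @ChainComplex subchain (fun n => @subbd n) subbdK.

Definition subcomplex_incl : chain_map subcomplex C :=
  @ChainMap subcomplex C (fun n => (val : {additive subchain n -> C n}))
    (fun n x => erefl).

End Subcomplex.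

Section Nerve.
Variable G : groupType.

Definition simplex n := {t : n.-tuple G | 1%g \notin t}.
HB.instance Definition _ n := Choice.on (simplex n).

(* In degree 0 this is free on the empty tuple. *)
Definition nerve n := {freeg (simplex n)}.
HB.instance Definition _ n := GRing.Lmodule.on (nerve n).

Definition symbol n (t : n.-tuple G) : nerve n :=
  if insub t is Some s then << (s : simplex n) >> else 0.

(* The i-th face of (g_1, ..., g_m), with g_j = [f j.-1] and 0 <= i <= m: its
   entries with j.+1 < i are kept, the entry j = i.-1 is g_{i+1} * g_i, and
   those after it are shifted; for i = 0 everything is shifted, so g_1 is
   deleted, and for i = m everything is kept but g_m. *)
Definition face_fun (i : nat) (f : nat -> G) (j : nat) : G :=
  if (j.+1 < i)%N then f j
  else if j.+1 == i then (f j.+1 * f j)%g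
  else f j.+1.

Definition face n (i : nat) (t : n.+1.-tuple G) : n.-tuple G :=
  [tuple face_fun i (nth 1%g t) j | j < n].

Definition nerve_bd n : nerve n.+1 -> nerve n :=
  fglift (fun s : simplex n.+1 =>
    \sum_(i < n.+2) (-1) ^+ i *: symbol (face i (val s))).

Fact nerve_bd_is_additive n : zmod_morphism (@nerve_bd n).
Proof. exact: lift_is_additive. Qed.
HB.instance Definition _ n :=
  GRing.isZmodMorphism.Build (nerve n.+1) (nerve n) (@nerve_bd n)
    (@nerve_bd_is_additive n).

Lemma nth_face n i (t : n.+1.-tuple G) j : (j < n)%N ->
  nth 1%g (face i t) j = face_fun i (nth 1%g t) j.
Proof. by move=> jn; rewrite -[j]/(val (Ordinal jn)) -tnth_nth tnth_mktuple. Qed.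

Lemma eq_face_fun i f g j : f j = g j -> f j.+1 = g j.+1 ->
  face_fun i f j = face_fun i g j.
Proof. by rewrite /face_fun => -> ->. Qed.

Lemma face_fun_comp (i j : nat) f m : (i <= j)%N ->
  face_fun i (face_fun j.+1 f) m = face_fun j (face_fun i f) m.
Proof.
move=> ij; rewrite /face_fun !ltnS !eqSS.
case: (ltngtP m.+1 i) => mi; case: (ltngtP m.+1 j) => mj;
  case: (ltngtP m j) => mj'; case: (ltngtP m.+2 i) => mi';
  rewrite ?mulgA //; exfalso; lia.
Qed.

Lemma face_face n (i j : nat) (t : n.+2.-tuple G) : (i <= j)%N ->
  face i (face j.+1 t) = face j (face i t).
Proof.
move=> ij; apply: eq_from_tnth => k; rewrite !tnth_mktuple.
transitivity (face_fun i (face_fun j.+1 (nth 1%g t)) k).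
  by apply: eq_face_fun; apply: nth_face; rewrite ltnS // ltnW.
rewrite face_fun_comp //.
by apply: eq_face_fun; symmetry; apply: nth_face; rewrite ltnS // ltnW.
Qed.

Lemma nerve_bd_symbol n (t : n.+1.-tuple G) :
  nerve_bd (symbol t) = \sum_(i < n.+2) (-1) ^+ i *: symbol (face i t).
Proof.
rewrite {1}/symbol; case: insubP => [s _ st|].
  by rewrite /nerve_bd liftU scale1r st.
rewrite negbK raddf0 => /(nthP 1%g)[k]; rewrite size_tuple => kn tk.
have symbol1 (i : nat) : i != k -> i != k.+1 -> (i < n.+2)%N ->
    symbol (face i t) = 0.
  move=> ik ikS i_n; rewrite /symbol insubF //; apply/negbTE; rewrite negbK.
  pose j := if (i < k)%N then k.-1 else k.
  have jn : (j < n)%N by rewrite /j; case: ifP => ?; lia.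
  apply/(nthP 1%g); exists j; first by rewrite size_tuple.
  rewrite nth_face // /face_fun /j.
  case: (ltnP i k) => ik'; last by rewrite ifT //; lia.
  by rewrite prednK ?(leq_trans _ ik') // [(k < i)%N]ltnNge ltnW //= gtn_eqF.
have faceE : face k t = face k.+1 t.
  apply: eq_from_tnth => j; rewrite !tnth_mktuple /face_fun !ltnS !eqSS.
  case: (ltngtP j k) => [jk|jk|->].
  - by case: (ltngtP j.+1 k) => [//||jSk]; [lia | rewrite jSk tk mul1g].
  - by case: (ltngtP j.+1 k) => //; lia.
  - by rewrite tk mulg1 [(k.+1 < k)%N]ltnNge leqnSn gtn_eqF.
pose k0 : 'I_n.+2 := Ordinal (ltnW kn : (k < n.+2)%N).
pose k1 : 'I_n.+2 := Ordinal (kn : (k.+1 < n.+2)%N).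
rewrite (bigD1 k0) //= (bigD1 k1) /=; last by rewrite -val_eqE /=; lia.
rewrite big1 => [|i /andP[i0 i1]]; last by rewrite symbol1 ?scaler0.
by rewrite addr0 -faceE exprS mulN1r scaleNr subrr.
Qed.

Lemma sum_simplicial0 (V : zmodType) m (F : nat -> nat -> V) :
  (forall i j, (i <= j)%N -> F j.+1 i = - F i j) ->
  \sum_(j < m.+1) \sum_(i < m) F j i = 0.
Proof.
move=> FE.
under eq_bigr => j _ do rewrite (bigID (fun i : 'I_m => (i < j)%N)) /=.
rewrite big_split /= [X in X + _]big_ord_recl [X in _ + X]big_ord_recr /=.
rewrite big1 ?add0r => [|//].
rewrite [X in _ + (_ + X)]big1 ?addr0 => [|i]; last by rewrite ltn_ord.
under eq_bigr => j _.
  under eq_bigr => i ij do rewrite /bump /= add1n FE //.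
  rewrite sumrN; over.
rewrite sumrN addrC; apply/eqP; rewrite subr_eq0; apply/eqP.
under eq_bigr => j _ do rewrite big_mkcond /=.
under [RHS]eq_bigr => j _ do rewrite big_mkcond /=.
rewrite exchange_big /=; apply: eq_bigr => i _; apply: eq_bigr => j _.
by rewrite /bump /= add1n -leqNgt ltnS.
Qed.

Fact nerve_bdK n (x : nerve n.+2) : nerve_bd (nerve_bd x) = 0.
Proof.
rewrite -[x]freeg_sumE !raddf_sum big1_seq // => s _ /=.
have -> : << coeff s x *g s >> = coeff s x *: symbol (val s) :> nerve _.
  rewrite /symbol valK; apply/eqP/freeg_eqP => u.
  by rewrite coeffZ !coeffU mul1r.
have nerve_bdZ m c (y : nerve m.+1) : nerve_bd (c *: y) = c *: nerve_bd y.
  by rewrite -[c]intz !scaler_int raddfMz.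
rewrite nerve_bdZ nerve_bd_symbol nerve_bdZ raddf_sum.
under eq_bigr => j _.
  rewrite /= nerve_bdZ nerve_bd_symbol scaler_sumr.
  under eq_bigr => i _ do rewrite scalerA.
  over.
rewrite /= (@sum_simplicial0 _ _ (fun j i => ((-1) ^+ j * (-1) ^+ i)
  *: symbol (face i (face j (val s))))) ?scaler0 // => i j ij.
by rewrite face_face // exprS mulN1r mulNr scaleNr mulrC.
Qed.

Definition nerve_complex : chain_complex :=
  @ChainComplex nerve (fun n => @nerve_bd n) nerve_bdK.

End Nerve.

Section Omega.
Variables (G : groupType) (M : set G).

Definition symbol_span n : set (nerve G n) :=
  [set x | exists s : seq (int * n.-tuple G),
     (forall p, p \in s -> forall g, g \in p.2 -> M g) /\
     x = \sum_(p <- s) p.1 *: symbol p.2].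

(* The differential leaving degree 0 is 0, so there is no condition there. *)
Definition omega n : {pred nerve G n} :=
  match n return {pred nerve G n} with
  | 0 => [pred x | `[< symbol_span x >]]
  | m.+1 => [pred x | `[< symbol_span x /\ symbol_span (nerve_bd x) >]]
  end.
Arguments omega : clear implicits.

Fact symbol_span0 n : symbol_span (0 : nerve G n).
Proof. by exists [::]; split=> //; rewrite big_nil. Qed.

Fact symbol_spanB n (x y : nerve G n) :
  symbol_span x -> symbol_span y -> symbol_span (x - y).
Proof.
move=> [s [sM ->]] [t [tM ->]].
exists (s ++ [seq (- p.1, p.2) | p <- t]); split=> [p|].
  by rewrite mem_cat => /orP[/sM|/mapP[q /tM qM ->]].
by rewrite big_cat big_map -sumrN; congr (_ + _);
  apply: eq_bigr => p _; rewrite scaleNr.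
Qed.

Fact omega_zmod_closed n : zmod_closed (omega n).
Proof.
case: n => [|n]; split=> /=.
- by apply/asboolP/symbol_span0.
- by move=> x y /asboolP xM /asboolP yM; apply/asboolP/symbol_spanB.
- by apply/asboolP; rewrite raddf0; split; apply: symbol_span0.
- move=> x y /asboolP[xM dxM] /asboolP[yM dyM]; apply/asboolP.
  by rewrite raddfB; split; apply: symbol_spanB.
Qed.
HB.instance Definition _ n :=
  GRing.isZmodClosed.Build (nerve G n) (omega n) (omega_zmod_closed n).

Fact omega_bd n (x : nerve_complex G n.+1) :
  x \in omega n.+1 -> bd (nerve_complex G) x \in omega n.
Proof.
move=> /asboolP[_ dxM]; case: n x dxM => [|n] x dxM; apply/asboolP => //.
by split=> //; rewrite /= nerve_bdK; apply: symbol_span0.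
Qed.

Definition omega_complex : chain_complex :=
  @subcomplex (nerve_complex G) omega
    omega_bd.

Definition omega_incl : chain_map omega_complex (nerve_complex G) :=
  @subcomplex_incl (nerve_complex G) omega
    omega_bd.

(* [homology_fun] is additive, so a bijective one is an isomorphism. *)
Definition coacyclic : Prop :=
  M 1%g /\ forall n, bijective (homology_fun omega_incl (n := n)).

End Omega.
Arguments omega {G} M n.

Definition wedge (G G' : groupType) (M : set G) (M' : set G') : set (G * G') :=
  (M `*` [set 1%g]) `|` ([set 1%g] `*` M').

Section FreeProduct.
Variables G G' : groupType.
Local Open Scope group_scope.
Implicit Types (x y z : G + G') (u v w : seq (G + G')).

(* Elements of the free product are reduced words: no letter is trivial and
   neighbouring letters come from different factors. *)
Definition fp_trivial x : bool :=
  match x with inl a => a == 1 | inr a => a == 1 end.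

Definition fp_same x y : bool :=
  match x, y with inl _, inl _ | inr _, inr _ => true | _, _ => false end.

Definition fp_reduced w : bool :=
  all [pred x | ~~ fp_trivial x] w && sorted [rel x y | ~~ fp_same x y] w.

Definition free_product := {w : seq (G + G') | fp_reduced w}.
HB.instance Definition _ := SubChoice.on free_product.

Definition fp_cons_nt x w : seq (G + G') := if fp_trivial x then w else x :: w.

(* The product of the letter x and the reduced word w. *)
Definition fp_cons x w : seq (G + G') :=
  match x, w with
  | inl a, inl b :: w' => fp_cons_nt (inl (a * b)) w'
  | inr a, inr b :: w' => fp_cons_nt (inr (a * b)) w'
  | _, _ => fp_cons_nt x w
  end.

Definition fp_letter_inv x : G + G' :=
  match x with inl a => inl a^-1 | inr a => inr a^-1 end.

Lemma fp_reduced_cons x w : fp_reduced (x :: w) =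
  [&& ~~ fp_trivial x, if w is y :: _ then ~~ fp_same x y else true & fp_reduced w].
Proof.
rewrite /fp_reduced; case: w => [|y w] /=; first by rewrite !andbT.
by case: (fp_trivial x) => //=; case: (fp_same x y); rewrite //= andbF.
Qed.

Lemma fp_cons_reduced x w : fp_reduced w -> fp_reduced (fp_cons x w).
Proof.
have nt z u : (if u is y :: _ then ~~ fp_same z y else true) -> fp_reduced u ->
    fp_reduced (fp_cons_nt z u).
  by move=> zu ru; rewrite /fp_cons_nt; case: ifP => // tz;
    rewrite fp_reduced_cons tz zu.
case: w => [|y w] rw; first by case: x => a; apply: nt.
move: (rw); rewrite fp_reduced_cons => /and3P[_ yw rw'].
by case: x y rw yw => a [] b rw yw; apply: nt => //; case: w {rw rw'} yw => [|[]].
Qed.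

Lemma fp_consK x w : fp_reduced (x :: w) -> fp_cons x w = x :: w.
Proof.
rewrite fp_reduced_cons => /and3P[/negbTE tx xw _].
by case: x w tx xw => a [|[] b w] //= ta; rewrite /fp_cons_nt /= ta.
Qed.

Lemma fp_cons1 x w : fp_trivial x -> fp_reduced w -> fp_cons x w = w.
Proof.
case: x => a /= /eqP -> rw; case: w rw => [|[] b w]; rewrite /= /fp_cons_nt /= ?eqxx //;
  by rewrite fp_reduced_cons mul1g => /and3P[/negbTE/= ->].
Qed.

Definition fp_same_mul x y : G + G' :=
  match x, y with
  | inl a, inl b => inl (a * b) | inr a, inr b => inr (a * b) | _, _ => x
  end.

Lemma fp_cons_cons x y w : fp_same x y -> fp_reduced w ->
  fp_cons x (fp_cons y w) = fp_cons (fp_same_mul x y) w.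
Proof.
move=> xy rw; have [ty|ty] := boolP (fp_trivial y).
  rewrite (fp_cons1 ty) //.
  by case: x y xy ty => a [] b //= _ /eqP ->; rewrite mulg1.
case: w rw => [|z w].
  by case: x y xy ty => a [] b //= _; rewrite /fp_cons_nt /= => /negbTE ->.
rewrite fp_reduced_cons => /and3P[tz zw rw].
have [yz|yz] := boolP (fp_same y z); last first.
  case: x y z xy ty tz yz zw => a [] b // [] c //= _ /negbTE tb /negbTE tc _ _;
    by rewrite /fp_cons_nt /= tb /=.
have nt t : fp_same t z -> fp_cons t w = fp_cons_nt t w.
  by case: t z w zw {tz rw yz} => ? [] ? [|[] ? ?].
have -> : fp_cons y (z :: w) = fp_cons (fp_same_mul y z) w.
  by rewrite nt; case: y z yz {nt ty tz zw xy} => ? [] ?.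
have -> : fp_cons (fp_same_mul x y) (z :: w)
    = fp_cons (fp_same_mul x (fp_same_mul y z)) w.
  by rewrite nt; case: x y z xy yz {nt ty tz zw} => ? [] ? // [] ? //=;
    rewrite mulgA.
have [tyz|tyz] := boolP (fp_trivial (fp_same_mul y z)).
  rewrite (fp_cons1 tyz) //; congr (fp_cons _ w).
  by case: x y z xy yz tyz {nt ty tz zw} => ? [] ? // [] ? //= _ _ /eqP ->;
    rewrite mulg1.
rewrite [in LHS]nt; last by case: y z yz {nt ty tz zw xy tyz} => ? [] ?.
rewrite [in RHS]nt; last by case: x y z xy yz {nt ty tz zw tyz} => ? [] ? // [] ?.
rewrite {1}/fp_cons_nt (negbTE tyz).
by case: x y z xy yz {nt ty tz zw tyz} => ? [] ? // [] ?.
Qed.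

Definition fp_cat u v : seq (G + G') := foldr fp_cons v u.

Lemma fp_cat_reduced u v : fp_reduced v -> fp_reduced (fp_cat u v).
Proof. by move=> rv; elim: u => //= x u; apply: fp_cons_reduced. Qed.

Lemma fp_cat_cons x u v : fp_reduced u -> fp_reduced v ->
  fp_cat (fp_cons x u) v = fp_cons x (fp_cat u v).
Proof.
move=> ru rv; have [tx|tx] := boolP (fp_trivial x).
  by rewrite !fp_cons1 // fp_cat_reduced.
case: u ru => [|y u] ru.
  by rewrite fp_consK // fp_reduced_cons tx.
have ruv : fp_reduced (fp_cat u v) by rewrite fp_cat_reduced.
have [xy|xy] := boolP (fp_same x y); last first.
  by rewrite (fp_consK (x := x)) // fp_reduced_cons tx xy.
rewrite /= fp_cons_cons //.
have -> : fp_cons x (y :: u) = fp_cons_nt (fp_same_mul x y) u.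
  by case: x y xy {tx ru} => ? [] ?.
by rewrite /fp_cons_nt; case: ifP => // txy; rewrite fp_cons1.
Qed.

Lemma fp_catA u v w : fp_reduced v -> fp_reduced w ->
  fp_cat u (fp_cat v w) = fp_cat (fp_cat u v) w.
Proof.
move=> rv rw; elim: u => //= x u ->.
by rewrite fp_cat_cons // fp_cat_reduced.
Qed.

Lemma fp_cat0 u : fp_reduced u -> fp_cat u [::] = u.
Proof.
elim: u => //= x u IH rxu; rewrite IH; first exact: fp_consK.
by move: rxu; rewrite fp_reduced_cons => /and3P[].
Qed.

Definition fp_word_inv w : seq (G + G') := rev (map fp_letter_inv w).

Lemma fp_word_invK w : fp_word_inv (fp_word_inv w) = w.
Proof.
rewrite /fp_word_inv map_rev revK -map_comp map_id_in // => -[] a _ /=;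
  by rewrite invgK.
Qed.

Lemma fp_word_inv_reduced w : fp_reduced w -> fp_reduced (fp_word_inv w).
Proof.
rewrite /fp_reduced /fp_word_inv all_rev all_map rev_sorted sorted_map => /andP[tw sw].
apply/andP; split.
  by apply: sub_all tw => -[] a /=; rewrite invg_eq1.
by apply: sub_sorted sw => -[] a [].
Qed.

Lemma fp_catVw w : fp_reduced w -> fp_cat (fp_word_inv w) w = [::].
Proof.
elim: w => //= x w IH rxw.
rewrite /fp_word_inv /= rev_cons /fp_cat foldr_rcons.
move: (rxw); rewrite fp_reduced_cons => /and3P[tx xw rw].
rewrite -(fp_consK rxw) fp_cons_cons //; last by case: {rxw tx xw} x.
rewrite fp_cons1 //; first exact: IH.
by case: {rxw tx xw} x => a /=; rewrite mulVg.
Qed.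

Definition fp_mul (s t : free_product) : free_product :=
  Sub (fp_cat (val s) (val t)) (fp_cat_reduced (val s) (valP t)).
Definition fp_one : free_product := Sub [::] (erefl : fp_reduced [::]).
Definition fp_inv (s : free_product) : free_product :=
  Sub (fp_word_inv (val s)) (fp_word_inv_reduced (valP s)).

Fact fp_mulA : associative fp_mul.
Proof. by move=> s t u; apply: val_inj; rewrite /= fp_catA //; apply: valP. Qed.
Fact fp_mul1 : left_id fp_one fp_mul.
Proof. by move=> s; apply: val_inj. Qed.
Fact fp_mulr1 : right_id fp_one fp_mul.
Proof. by move=> s; apply: val_inj; rewrite /= fp_cat0 //; apply: valP. Qed.
Fact fp_mulV : left_inverse fp_one fp_inv fp_mul.
Proof. by move=> s; apply: val_inj; rewrite /= fp_catVw //; apply: valP. Qed.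
Fact fp_mulrV : right_inverse fp_one fp_inv fp_mul.
Proof.
move=> s; apply: val_inj; rewrite /= -{1}[val s]fp_word_invK fp_catVw //.
exact/fp_word_inv_reduced/valP.
Qed.
HB.instance Definition _ :=
  isGroup.Build free_product fp_mulA fp_mul1 fp_mulr1 fp_mulV fp_mulrV.

Definition fp_inl (a : G) : free_product :=
  Sub (fp_cons (inl a) [::]) (fp_cons_reduced (inl a) (erefl : fp_reduced [::])).
Definition fp_inr (a : G') : free_product :=
  Sub (fp_cons (inr a) [::]) (fp_cons_reduced (inr a) (erefl : fp_reduced [::])).

Fact fp_inlM : {morph fp_inl : a b / a * b}.
Proof.
move=> a b; apply: val_inj; symmetry.
apply: etrans (fp_cat_cons (inl a) _ _) _ => //; first exact: fp_cons_reduced.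
exact: (@fp_cons_cons (inl a) (inl b)).
Qed.
Fact fp_inl1 : fp_inl 1 = 1.
Proof. by apply: val_inj; rewrite /= /fp_cons_nt /= eqxx. Qed.
HB.instance Definition _ := isMultiplicative.Build G free_product fp_inl fp_inlM.
HB.instance Definition _ :=
  Multiplicative_isUMagmaMorphism.Build G free_product fp_inl fp_inl1.

Fact fp_inrM : {morph fp_inr : a b / a * b}.
Proof.
move=> a b; apply: val_inj; symmetry.
apply: etrans (fp_cat_cons (inr a) _ _) _ => //; first exact: fp_cons_reduced.
exact: (@fp_cons_cons (inr a) (inr b)).
Qed.
Fact fp_inr1 : fp_inr 1 = 1.
Proof. by apply: val_inj; rewrite /= /fp_cons_nt /= eqxx. Qed.
HB.instance Definition _ := isMultiplicative.Build G' free_product fp_inr fp_inrM.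
HB.instance Definition _ :=
  Multiplicative_isUMagmaMorphism.Build G' free_product fp_inr fp_inr1.

Lemma free_product_univ (K : groupType)
    (f : {multiplicative G -> K}) (f' : {multiplicative G' -> K}) :
  exists2 h : free_product -> K,
    [/\ {morph h : s t / s * t}, h \o fp_inl =1 f & h \o fp_inr =1 f'] &
    forall h' : free_product -> K,
      [/\ {morph h' : s t / s * t}, h' \o fp_inl =1 f & h' \o fp_inr =1 f'] ->
      h' =1 h.
Proof.
have morph1 (A : groupType) (k : A -> K) : {morph k : a b / a * b} -> k 1 = 1.
  by move=> kM; apply: (mulgI (k 1)); rewrite -kM !mulg1.
have f1 : f 1 = 1 by apply: (morph1 _ f) => a b; exact: gmulfM.
have f'1 : f' 1 = 1 by apply: (morph1 _ f') => a b; exact: gmulfM.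
pose ev x := match x with inl a => f a | inr a => f' a end.
pose evw := foldr (fun x k => ev x * k) 1.
have ev_nt x w : evw (fp_cons_nt x w) = ev x * evw w.
  by rewrite /fp_cons_nt; case: x => a /=; case: eqP => //= ->;
    rewrite ?f1 ?f'1 mul1g.
have ev_cons x w : evw (fp_cons x w) = ev x * evw w.
  by case: x w => a [|[] b w] //=; rewrite ev_nt //= ?gmulfM mulgA.
have ev_cat u v : evw (fp_cat u v) = evw u * evw v.
  by elim: u => [|x u IH] /=; rewrite ?mul1g // ev_cons IH mulgA.
exists (fun s => evw (val s)).
  split=> [s t|a|a]; first exact: ev_cat.
    by rewrite /= ev_nt mulg1.
  by rewrite /= ev_nt mulg1.
move=> h [hM hl hr] [w rw] /=; elim: w rw => [|x w IH] rw.
  by transitivity (h 1); [congr h; apply: val_inj | exact: morph1].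
have rw' : fp_reduced w by move: rw; rewrite fp_reduced_cons => /and3P[].
pose sx := match x with inl a => fp_inl a | inr a => fp_inr a end.
have -> : exist (fun w => fp_reduced w) (x :: w) rw = sx * exist _ w rw'.
  apply: val_inj; rewrite -[LHS](fp_consK rw) /sx /=.
  by case: x {IH rw sx} => a; rewrite -[w in LHS]/(fp_cat [::] w) -fp_cat_cons.
rewrite hM IH /=; congr (_ * _).
by rewrite /sx; case: x {IH rw sx} => a; [apply: hl | apply: hr].
Qed.

End FreeProduct.

(* Main.v *)
From HB Require Import structures.
From mathcomp Require Import all_boot all_algebra.
From mathcomp Require Import boolp classical_sets.
From mathcomp Require Import freeg zify ring.
Require Import Defs.

(** M is coacyclic iff the quotient of the nerve by Omega(G, M) is acyclic,
    and this can be said without Omega: every chain x whose boundary is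
    supported on words in M differs by a boundary from a chain supported on
    words in M.

    In a group with length-preserving quadratic normal forms, inserting a bar
    at the first place where an entry can be split into a reduced product is,
    up to terms of lower weight, a contracting homotopy away from the words
    that have no such place. For G * G' the remaining words are those with all
    letters in one factor, and the two projections of G * G' reduce the claim
    to G and G'. For G x G' they are the words a_1 ... a_p b_1 ... b_q, and
    the chain with leading term such a word is the shuffle product of its two
    halves, so that the claim becomes a Künneth statement for the tensor
    product of the nerves of G and G'. There one filters by the degree of one
    factor; since Omega is a pure subgroup, any finite part of it is a direct
    summand, which replaces the freeness of Omega. *)

Set Implicit Arguments.
Unset Strict Implicit.
Unset Printing Implicit Defensive.

Import GRing.Theory.

(** * Free abelian groups and words *)

Section FreeAbelian.
Local Open Scope ring_scope.

(** The condition on the quotient speaks of supports only because a boundary is a cycle, hence lies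
    in Omega as soon as its words lie in M. Supports can be checked term by term, whereas Omega has
    no basis of words. The bar-inserting homotopy h changes a chain T by d h T + h d T. This is
    where the hypothesis on dT enters: the entries of its words come from a single factor each and
    are too short to be cut, so h d T = 0 and T changes by a boundary. The induction on the weight
    needs this hypothesis again after the surviving words are subtracted, so these must be completed
    to chains whose boundary is of the same kind. In G * G' a word with all letters in one factor
    needs no completion, the factor being closed under products. In G x G' the face of a_1 ... a_p
    b_1 ... b_q that merges a_p and b_1 creates the entry (a_p, b_1), which can be cut; in the
    shuffle product such faces cancel in pairs. For G * G' the number of letters is a sufficient
    weight. In G x G' the merging of (a, 1) and (1, b) in the wrong order loses no letter, so pairs
    in the wrong order are counted as well. *)

Definition lin (T : choiceType) (V : lmodType int) (f : T -> V) :
  {freeg T} -> V := fglift f.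

Fact lin_is_additive (T : choiceType) (V : lmodType int) (f : T -> V) :
  zmod_morphism (lin f).
Proof. exact: lift_is_additive. Qed.
HB.instance Definition _ (T : choiceType) (V : lmodType int) (f : T -> V) :=
  GRing.isZmodMorphism.Build {freeg T} V (lin f) (lin_is_additive f).

Lemma linU (T : choiceType) (V : lmodType int) (f : T -> V) s :
  lin f << s >> = f s.
Proof. by rewrite /lin liftU scale1r. Qed.

Lemma raddfZint (U V : lmodType int) (F : {additive U -> V}) (n : int) x :
  F (n *: x) = n *: F x.
Proof. by rewrite -[n]intz !scaler_int raddfMz. Qed.

Variables (T : choiceType).
Implicit Types (Q R : T -> Prop) (x y : {freeg T}).

Record supp Q x : Prop := Supp { suppP : forall s, coeff s x != 0 -> Q s }.

Lemma supp0 Q : supp Q 0.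
Proof. by split=> s; rewrite coeff0 eqxx. Qed.

Lemma suppB Q x y : supp Q x -> supp Q y -> supp Q (x - y).
Proof.
move=> xQ yQ; split=> s; rewrite coeffB => nz.
have [xs|/(suppP xQ)//] := eqVneq (coeff s x) 0.
by apply: (suppP yQ); apply: contraNneq nz => ys; rewrite xs ys subrr.
Qed.

Lemma suppN Q x : supp Q x -> supp Q (- x).
Proof. by move=> xQ; rewrite -sub0r; apply: suppB => //; apply: supp0. Qed.

Lemma suppD Q x y : supp Q x -> supp Q y -> supp Q (x + y).
Proof. by move=> xQ yQ; rewrite -[y]opprK; apply: suppB => //; apply: suppN. Qed.

Lemma suppZ Q (n : int) x : supp Q x -> supp Q (n *: x).
Proof.
move=> xQ; split=> s; rewrite coeffZ => nz; apply: (suppP xQ).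
by apply: contraNneq nz => ->; rewrite mulr0.
Qed.

Lemma suppU Q s : Q s -> supp Q << s >>.
Proof. by move=> Qs; split=> u; rewrite coeffU mul1r; case: (s =P u) => [<- //|_]; rewrite eqxx. Qed.

Lemma supp_sum Q (I : Type) (r : seq I) (P : pred I) (F : I -> {freeg T}) :
  (forall i, P i -> supp Q (F i)) -> supp Q (\sum_(i <- r | P i) F i).
Proof. by move=> FQ; elim/big_rec: _ => [|i x Pi]; [apply: supp0 | apply: suppD; apply: FQ]. Qed.

Lemma sub_supp Q R x : (forall s, Q s -> R s) -> supp Q x -> supp R x.
Proof. by move=> QR xQ; split=> s /(suppP xQ)/QR. Qed.

Lemma supp_dom x : supp (fun s => s \in dom x) x.
Proof. by split=> s; rewrite mem_dom. Qed.

Lemma supp_ind Q (C : {freeg T} -> Prop) :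
    C 0 -> (forall x y, C x -> C y -> C (x - y)) -> (forall s, Q s -> C << s >>) ->
  forall x, supp Q x -> C x.
Proof.
move=> C0 CB CU x xQ.
have CN y : C y -> C (- y) by move=> Cy; rewrite -sub0r; apply: CB.
have CD y z : C y -> C z -> C (y + z).
  by move=> Cy Cz; rewrite -[z]opprK; apply: CB => //; apply: CN.
have CMn n y : C y -> C (y *+ n).
  by move=> Cy; elim: n => [|n IHn]; rewrite ?mulr0n // mulrS; apply: CD.
rewrite -[x]freeg_sumE big_seq; elim/big_rec: _ => // s y.
rewrite mem_dom => /(suppP xQ)/CU Cs; apply: CD.
have -> : << coeff s x *g s >> = << s >> *~ coeff s x :> {freeg T}.
  by rewrite freeg_mulz intz.
by case: (coeff s x) => n; [|apply/CN]; apply: CMn.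
Qed.

Lemma freeg_ind (C : {freeg T} -> Prop) :
    C 0 -> (forall x y, C x -> C y -> C (x - y)) -> (forall s, C << s >>) ->
  forall x, C x.
Proof. by move=> C0 CB CU x; apply: (@supp_ind (fun=> True)) => // s _; apply: CU. Qed.

Lemma eq_additive_supp Q (V : zmodType) (F1 F2 : {additive {freeg T} -> V}) :
  (forall s, Q s -> F1 << s >> = F2 << s >>) ->
  forall x, supp Q x -> F1 x = F2 x.
Proof.
by move=> F12; apply: supp_ind => [|x y xE yE|//]; rewrite ?raddf0 // !raddfB xE yE.
Qed.

End FreeAbelian.

(* Identities between combinations of chains, checked coefficientwise. *)
Ltac chain_ring := apply/eqP/freeg_eqP => ?;
  rewrite ?(coeffB, coeffD, coeffN, coeffZ, coeff0); ring.

Section FreeAbelianMaps.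
Local Open Scope ring_scope.

Lemma supp_additive (T T' : choiceType) (Q : T -> Prop) (Q' : T' -> Prop)
    (F : {additive {freeg T} -> {freeg T'}}) :
  (forall s, Q s -> supp Q' (F << s >>)) -> forall x, supp Q x -> supp Q' (F x).
Proof.
move=> FQ; apply: supp_ind => [|x y xE yE|//].
  by rewrite raddf0; apply: supp0.
by rewrite raddfB; apply: suppB.
Qed.

End FreeAbelianMaps.

(** * The normalized bar complex on words of all lengths *)

Section Words.
Local Open Scope ring_scope.
Variable P : groupType.
Implicit Types (x y z w : P) (s t r : seq P).

(** Lists rather than tuples: chains have mixed degrees, so that inserting or merging entries never
    changes the type. The grading is recovered by [wproj]. *)
Definition word := {t : seq P | 1%g \notin t}.
HB.instance Definition _ := SubChoice.on word.
Definition wchain := {freeg word}.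
HB.instance Definition _ := GRing.Lmodule.on wchain.

Definition sym t : wchain := if insub t is Some s then << (s : word) >> else 0.

Lemma sym_val (s : word) : sym (val s) = << s >>.
Proof. by rewrite /sym valK. Qed.

Lemma sym0 t : 1%g \in t -> sym t = 0.
Proof. by move=> t1; rewrite /sym insubF // t1. Qed.

Definition wsupp (Q : seq P -> Prop) : wchain -> Prop :=
  supp (fun s : word => Q (val s)).

Lemma wsupp0 Q : wsupp Q 0.
Proof. exact: supp0. Qed.

Lemma wsuppB Q u v : wsupp Q u -> wsupp Q v -> wsupp Q (u - v).
Proof. exact: suppB. Qed.

Lemma wsuppN Q u : wsupp Q u -> wsupp Q (- u).
Proof. exact: suppN. Qed.

Lemma wsuppD Q u v : wsupp Q u -> wsupp Q v -> wsupp Q (u + v).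
Proof. exact: suppD. Qed.

Lemma wsuppZ Q (n : int) u : wsupp Q u -> wsupp Q (n *: u).
Proof. exact: suppZ. Qed.

Lemma wsupp_sum Q (I : Type) (r : seq I) (p : pred I) (F : I -> wchain) :
  (forall i, p i -> wsupp Q (F i)) -> wsupp Q (\sum_(i <- r | p i) F i).
Proof. exact: supp_sum. Qed.

Lemma sub_wsupp Q R u : (forall t, Q t -> R t) -> wsupp Q u -> wsupp R u.
Proof. by move=> QR; apply: sub_supp => s /QR. Qed.

Lemma wsuppI Q R u : wsupp Q u -> wsupp R u -> wsupp (fun t => Q t /\ R t) u.
Proof. by move=> uQ uR; split=> s nz; split; [apply: (suppP uQ) | apply: (suppP uR)]. Qed.

Lemma wsupp_sym Q t : (1%g \notin t -> Q t) -> wsupp Q (sym t).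
Proof.
rewrite /sym; case: insubP => [s -> <- Qs|_ _]; last exact: supp0.
by apply: suppU; apply: Qs.
Qed.

Lemma wsupp_ind Q (C : wchain -> Prop) :
    C 0 -> (forall u v, C u -> C v -> C (u - v)) ->
    (forall t, 1%g \notin t -> Q t -> C (sym t)) ->
  forall u, wsupp Q u -> C u.
Proof.
move=> C0 CB CS; apply: supp_ind => // s Qs.
by rewrite -sym_val; apply: CS => //; exact: (valP s).
Qed.

Lemma wchain_ind (C : wchain -> Prop) :
    C 0 -> (forall u v, C u -> C v -> C (u - v)) ->
    (forall t, 1%g \notin t -> C (sym t)) ->
  forall u, C u.
Proof.
by move=> C0 CB CS u; apply: (@wsupp_ind (fun=> True)) => // t tn _; apply: CS.
Qed.

Lemma eq_additive_wsupp Q (V : zmodType) (F1 F2 : {additive wchain -> V}) :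
  (forall t, 1%g \notin t -> Q t -> F1 (sym t) = F2 (sym t)) ->
  forall u, wsupp Q u -> F1 u = F2 u.
Proof.
move=> F12; apply: wsupp_ind => [|x y xE yE|//]; first by rewrite !raddf0.
by rewrite !raddfB xE yE.
Qed.

Lemma eq_additive_word (V : zmodType) (F1 F2 : {additive wchain -> V}) :
  (forall t, 1%g \notin t -> F1 (sym t) = F2 (sym t)) -> F1 =1 F2.
Proof.
by move=> F12 u; apply: (@eq_additive_wsupp (fun=> True)) => [t /F12 //|].
Qed.

Lemma wsupp_additive Q (T : choiceType) (R : T -> Prop)
    (F : {additive wchain -> {freeg T}}) :
  (forall t, 1%g \notin t -> Q t -> supp R (F (sym t))) ->
  forall u, wsupp Q u -> supp R (F u).
Proof.
move=> FQ; apply: wsupp_ind => [|x y xE yE|//].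
  by rewrite raddf0; apply: supp0.
by rewrite raddfB; apply: suppB.
Qed.

Definition wlin (V : lmodType int) (f : seq P -> V) : wchain -> V :=
  lin (fun s : word => f (val s)).
HB.instance Definition _ (V : lmodType int) (f : seq P -> V) :=
  GRing.Additive.on (wlin f).

Lemma wlin_sym (V : lmodType int) (f : seq P -> V) t :
  (1%g \in t -> f t = 0) -> wlin f (sym t) = f t.
Proof.
rewrite /sym; case: insubP => [s _ <- _|]; first by rewrite /wlin linU.
by rewrite negbK raddf0 => -> ->.
Qed.

Lemma wlin_word (V : lmodType int) (f : seq P -> V) t :
  1%g \notin t -> wlin f (sym t) = f t.
Proof. by move=> t1; rewrite wlin_sym // (negbTE t1). Qed.

Lemma wsuppT u : wsupp (fun=> True) u.
Proof. by split. Qed.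

Definition wcons x : wchain -> wchain := wlin (fun t => sym (x :: t)).
HB.instance Definition _ x := GRing.Additive.on (wcons x).

Lemma wcons_sym x t : wcons x (sym t) = sym (x :: t).
Proof. by rewrite /wcons wlin_sym // => t1; rewrite sym0 // inE t1 orbT. Qed.

Lemma wcons1 T : wcons 1%g T = 0.
Proof.
elim/wchain_ind: T => [|u v uE vE|t _]; first by rewrite raddf0.
  by rewrite raddfB /= uE vE subrr.
by rewrite wcons_sym sym0 ?mem_head.
Qed.

Lemma wsupp_wcons Q (R : seq P -> Prop) x T :
  (forall t, 1%g \notin x :: t -> Q t -> R (x :: t)) -> wsupp Q T -> wsupp R (wcons x T).
Proof.
move=> QR; apply: wsupp_additive => t _ Qt; rewrite /= wcons_sym.
by apply: wsupp_sym => xt1; apply: QR.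
Qed.

(* The boundary of x :: t is t - beta_word x t: the faces other than the zeroth. *)
Fixpoint beta_word x t : wchain :=
  if t is y :: r then sym ((y * x)%g :: r) - wcons x (beta_word y r) else sym [::].

Definition beta x : wchain -> wchain := wlin (beta_word x).
HB.instance Definition _ x := GRing.Additive.on (beta x).

(** Merging a leading 1 into its neighbour gives [t] back, and every later face keeps the 1 and is
    degenerate. Against the zeroth face this makes the boundary vanish on degenerate words. *)
Lemma beta_word1 t : beta_word 1%g t = sym t.
Proof. by case: t => //= y r; rewrite mulg1 wcons1 subr0. Qed.

Lemma beta_word_deg x t : 1%g \in t -> beta_word x t = 0.
Proof.
elim: t x => //= y r IHr x; rewrite inE eq_sym => /predU1P[->|r1].
  by rewrite mul1g beta_word1 wcons_sym subrr.
by rewrite IHr // raddf0 subr0 sym0 // inE r1 orbT.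
Qed.

Lemma beta_sym x t : beta x (sym t) = beta_word x t.
Proof. by rewrite /beta wlin_sym //; apply: beta_word_deg. Qed.

Lemma beta_wcons x y T : beta x (wcons y T) = wcons (y * x)%g T - wcons x (beta y T).
Proof.
elim/wchain_ind: T => [|T T' TE T'E|t _]; first by rewrite !raddf0 addr0.
  by rewrite !raddfB /= TE T'E; chain_ring.
by rewrite !wcons_sym !beta_sym.
Qed.

(** This replaces the simplicial identities: with [wbd_wcons] it yields that the boundary squares to
    0. *)
Lemma beta_beta x y T : beta x (beta y T) = beta (y * x)%g T.
Proof.
elim/wchain_ind: T => [|T T' TE T'E|t _]; first by rewrite !raddf0.
  by rewrite !raddfB /= TE T'E.
rewrite !beta_sym; elim: t x y => [|z t IHt] x y /=; first by rewrite beta_sym.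
rewrite raddfB /= beta_sym /= beta_wcons IHt mulgA; chain_ring.
Qed.

Definition bd_word t : wchain := if t is x :: r then sym r - beta_word x r else 0.

Definition wbd : wchain -> wchain := wlin bd_word.
HB.instance Definition _ := GRing.Additive.on wbd.

Lemma wbd_sym t : wbd (sym t) = bd_word t.
Proof.
rewrite /wbd wlin_sym //; case: t => //= x t; rewrite inE eq_sym => /predU1P[->|t1].
  by rewrite beta_word1 subrr.
by rewrite beta_word_deg // sym0 // subr0.
Qed.

Lemma wbd_wcons x T : wbd (wcons x T) = T - beta x T.
Proof.
elim/wchain_ind: T => [|T T' TE T'E|t _]; first by rewrite !raddf0 addr0.
  by rewrite !raddfB /= TE T'E; chain_ring.
by rewrite !wcons_sym !beta_sym wbd_sym.
Qed.

Lemma wbdK u : wbd (wbd u) = 0.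
Proof.
elim/wchain_ind: u => [|u v uE vE|t _]; first by rewrite !raddf0.
  by rewrite !raddfB /= uE vE subrr.
rewrite wbd_sym; case: t => [|x [|y t]]; rewrite /= ?raddf0 //.
  by rewrite subrr raddf0.
rewrite !raddfB /= wbd_wcons !wbd_sym /= -!beta_sym beta_beta; chain_ring.
Qed.

End Words.

Lemma wsupp_hom (P P' : groupType) Q (R : seq P' -> Prop)
    (F : {additive wchain P -> wchain P'}) :
  (forall t, 1%g \notin t -> Q t -> wsupp R (F (sym t))) ->
  forall u, wsupp Q u -> wsupp R (F u).
Proof. exact: wsupp_additive. Qed.

Section Functoriality.
Local Open Scope ring_scope.
Variables (P Q : groupType) (f : P -> Q).
Hypotheses (f1 : f 1%g = 1%g) (fM : {morph f : x y / (x * y)%g}).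

Definition wmap : wchain P -> wchain Q := wlin (fun t => sym (map f t)).
HB.instance Definition _ := GRing.Additive.on wmap.

Lemma wmap_sym t : wmap (sym t) = sym (map f t).
Proof. by rewrite /wmap wlin_sym // => t1; rewrite sym0 // -f1 map_f. Qed.

Lemma wmap_wcons x u : wmap (wcons x u) = wcons (f x) (wmap u).
Proof.
elim/wchain_ind: u => [|u v uE vE|t _]; first by rewrite !raddf0.
  by rewrite !raddfB /= uE vE.
by rewrite wcons_sym !wmap_sym wcons_sym.
Qed.

Lemma wmap_beta_word x t : wmap (beta_word x t) = beta_word (f x) (map f t).
Proof.
elim: t x => [|y t IHt] x /=; first by rewrite wmap_sym.
by rewrite raddfB /= wmap_sym wmap_wcons IHt /= fM.
Qed.

Lemma wbd_wmap u : wbd (wmap u) = wmap (wbd u).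
Proof.
elim/wchain_ind: u => [|u v uE vE|t _]; first by rewrite !raddf0.
  by rewrite !raddfB /= uE vE.
rewrite wmap_sym !wbd_sym; case: t => [|x t] /=; first by rewrite raddf0.
by rewrite raddfB /= wmap_sym wmap_beta_word.
Qed.

End Functoriality.

(** * The grading by word length *)

Section Degree.
Local Open Scope ring_scope.
Variable P : groupType.
Implicit Types (x y : P) (t : seq P) (u v : wchain P).

Definition deg_is n : seq P -> Prop := fun t => size t = n.

Lemma wsupp_beta_word x t : wsupp (deg_is (size t)) (beta_word x t).
Proof.
elim: t x => [|y t IHt] x /=; first exact: wsupp_sym.
apply: wsuppB; first exact: wsupp_sym.
by apply: wsupp_wcons (IHt y) => s _ sz; rewrite /deg_is /= sz.
Qed.

Lemma wsupp_bd_word t : wsupp (deg_is (size t).-1) (bd_word t).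
Proof.
case: t => [|x t] /=; first exact: wsupp0.
by apply: wsuppB; [exact: wsupp_sym | exact: wsupp_beta_word].
Qed.

Definition wproj n : wchain P -> wchain P :=
  wlin (fun t => if size t == n then sym t else 0).
HB.instance Definition _ n := GRing.Additive.on (wproj n).

Lemma wproj_sym n t : wproj n (sym t) = if size t == n then sym t else 0.
Proof. by rewrite /wproj wlin_sym // => t1; rewrite sym0 // if_same. Qed.

Lemma wsupp_wproj n Q u : wsupp Q u -> wsupp (fun t => size t = n /\ Q t) (wproj n u).
Proof.
apply: wsupp_hom => t _ Qt; rewrite /= wproj_sym.
by case: eqP => tn; [apply: wsupp_sym | apply: wsupp0].
Qed.

Lemma wproj_id n u : wsupp (deg_is n) u -> wproj n u = u.
Proof.
apply: (eq_additive_wsupp (F1 := wproj n) (F2 := idfun)) => t _ tn.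
by rewrite /= wproj_sym tn eqxx.
Qed.

Lemma wproj_eq0 m n u : m != n -> wsupp (deg_is m) u -> wproj n u = 0.
Proof.
move=> mn; apply: (eq_additive_wsupp (F1 := wproj n) (F2 := \0)) => t _ tm.
by rewrite /= wproj_sym tm (negbTE mn).
Qed.

Lemma wbd_wproj n u : wbd (wproj n.+1 u) = wproj n (wbd u).
Proof.
elim/wchain_ind: u => [|u v uE vE|t _]; first by rewrite !raddf0.
  by rewrite !raddfB /= uE vE.
rewrite wproj_sym wbd_sym; have bdt := wsupp_bd_word t.
case: eqP => [tn|tn]; first by rewrite wbd_sym wproj_id // -[n]/(n.+1.-1) -tn.
case: t tn bdt => [|x t] tn bdt; first by rewrite !raddf0.
by rewrite raddf0 (wproj_eq0 _ bdt) //; apply/eqP => tn'; apply: tn; rewrite -tn'.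
Qed.

Lemma sum_wproj u : exists N, u = \sum_(n < N) wproj n u.
Proof.
(* All larger bounds are allowed, so that the bounds of two chains can be replaced by their
   maximum. *)
suff [N uN] : exists N, forall m, (N <= m)%N -> u = \sum_(n < m) wproj n u.
  by exists N; apply: uN.
elim/wchain_ind: u => [|u v [N uE] [M vE]|t _].
- by exists 0%N => m _; rewrite big1 // => i _; rewrite raddf0.
- exists (maxn N M) => m; rewrite geq_max => /andP[Nm Mm].
  by rewrite {1}(uE m Nm) {1}(vE m Mm) -sumrB; apply: eq_bigr => i _; rewrite raddfB.
- exists (size t).+1 => m tm; rewrite (bigD1 (Ordinal tm)) //= wproj_sym eqxx.
  rewrite big1 ?addr0 // => i; rewrite -val_eqE /= wproj_sym eq_sym.
  by move=> /negbTE ->.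
Qed.

End Degree.

(** * Comparison of word chains with the nerve *)

Section NerveWords.
Local Open Scope ring_scope.
Variable G : groupType.
Implicit Types (t : seq G) (u v : wchain G).

Definition sface i t : seq G := mkseq (face_fun i (nth 1%g t)) (size t).-1.

Lemma sface0 x t : sface 0 (x :: t) = t.
Proof.
apply: (@eq_from_nth _ 1%g); rewrite size_mkseq // => i it.
by rewrite nth_mkseq.
Qed.

Lemma sface1 x y t : sface 1 (x :: y :: t) = (y * x)%g :: t.
Proof.
apply: (@eq_from_nth _ 1%g); rewrite size_mkseq // => -[|i] it.
  by rewrite nth_mkseq.
by rewrite nth_mkseq.
Qed.

Lemma sfaceS i x y t : sface i.+2 (x :: y :: t) = x :: sface i.+1 (y :: t).
Proof.
apply: (@eq_from_nth _ 1%g); first by rewrite /= !(size_mkseq, size_map, size_iota).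
rewrite size_mkseq => -[|j] jt; first by rewrite nth_mkseq // /face_fun.
by rewrite nth_mkseq //= nth_mkseq // /face_fun /= ltnS eqSS.
Qed.

Lemma beta_wordE x t : beta_word x t =
  \sum_(i < (size t).+1) (-1) ^+ i *: sym (sface i.+1 (x :: t)).
Proof.
elim: t x => [|y t IHt] x /=; first by rewrite big_ord1 scale1r.
rewrite big_ord_recl /= scale1r sface1 IHt raddf_sum -sumrN; congr (_ + _).
apply: eq_bigr => i _; rewrite raddfZint /= wcons_sym /bump /= add1n sfaceS.
by rewrite exprS mulN1r scaleNr.
Qed.

Lemma bd_wordE x t : bd_word (x :: t) =
  \sum_(i < (size t).+2) (-1) ^+ i *: sym (sface i (x :: t)).
Proof.
rewrite big_ord_recl /= sface0 scale1r beta_wordE -sumrN; congr (_ + _).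
by apply: eq_bigr => i _; rewrite /bump /= add1n exprS mulN1r scaleNr.
Qed.

Lemma val_face n i (t : n.+1.-tuple G) : val (face i t) = sface i t.
Proof.
apply: (@eq_from_nth _ 1%g); rewrite !size_tuple ?size_mkseq //= => j jn.
by rewrite nth_face // nth_mkseq // size_tuple.
Qed.

Lemma nerve_ind n (C : nerve G n -> Prop) :
    C 0 -> (forall x y, C x -> C y -> C (x - y)) ->
    (forall t : n.-tuple G, 1%g \notin t -> C (symbol t)) ->
  forall x, C x.
Proof.
move=> C0 CB CS x; apply: (@supp_ind _ (fun=> True)) => // s _.
have -> : << s >> = symbol (val s) by rewrite /symbol valK.
by apply: CS; apply: (valP s).
Qed.

Definition nerve_word n : nerve G n -> wchain G :=
  lin (fun s : simplex G n => sym (val (val s))).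
HB.instance Definition _ n := GRing.Additive.on (@nerve_word n).

Lemma nerve_word_symbol n (t : n.-tuple G) : nerve_word (symbol t) = sym t.
Proof.
rewrite /symbol; case: insubP => [s _ <-|]; first by rewrite /nerve_word linU.
by rewrite negbK raddf0 => t1; rewrite sym0.
Qed.

Definition word_nerve n : wchain G -> nerve G n :=
  wlin (fun t => if insub t is Some t' then symbol (t' : n.-tuple G) else 0).
HB.instance Definition _ n := GRing.Additive.on (@word_nerve n).

Lemma symbol_deg n (t : n.-tuple G) : 1%g \in t -> symbol t = 0.
Proof. by move=> t1; rewrite /symbol insubF // t1. Qed.

Lemma word_nerve_sym n t :
  word_nerve n (sym t) = if insub t is Some t' then symbol (t' : n.-tuple G) else 0.
Proof.
rewrite /word_nerve wlin_sym // => t1; case: insubP => //= t' _ tE.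
by move: t1; rewrite -tE => /symbol_deg.
Qed.

Lemma nerve_wordK n : cancel (@nerve_word n) (@word_nerve n).
Proof.
move=> x; elim/nerve_ind: x => [|x y xE yE|t _]; first by rewrite !raddf0.
  by rewrite !raddfB /= xE yE.
by rewrite nerve_word_symbol word_nerve_sym valK.
Qed.

Lemma word_nerveK n u : nerve_word (word_nerve n u) = wproj n u.
Proof.
elim/wchain_ind: u => [|u v uE vE|t _]; first by rewrite !raddf0.
  by rewrite !raddfB /= uE vE.
rewrite word_nerve_sym wproj_sym; case: insubP => [t' -> <-|/negbTE ->].
  by rewrite nerve_word_symbol.
by rewrite raddf0.
Qed.

Lemma wbd_nerve_word n (x : nerve G n.+1) : wbd (nerve_word x) = nerve_word (nerve_bd x).
Proof.
elim/nerve_ind: x => [|x y xE yE|t _]; first by rewrite !raddf0.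
  by rewrite !raddfB /= xE yE.
rewrite nerve_word_symbol wbd_sym nerve_bd_symbol raddf_sum.
transitivity (\sum_(i < n.+2) (-1) ^+ i *: sym (sface i t)).
  case: t => -[|x t] //= /eqP[tn]; rewrite -[LHS]/(bd_word (x :: t)) bd_wordE.
  by rewrite tn.
by apply: eq_bigr => i _; rewrite raddfZint /= nerve_word_symbol val_face.
Qed.

Lemma nerve_bd_word_nerve n u :
  nerve_bd (word_nerve n.+1 u) = word_nerve n (wbd u).
Proof.
apply: (can_inj (@nerve_wordK n)).
by rewrite -wbd_nerve_word !word_nerveK wbd_wproj.
Qed.

Definition word_in (M : set G) t := forall g, g \in t -> M g.

Lemma symbol_span_word_nerve M n u :
  wsupp (word_in M) u -> symbol_span M (word_nerve n u).
Proof.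
move: u; apply: wsupp_ind => [|u v uM vM|t _ tM].
- by rewrite raddf0; apply: symbol_span0.
- by rewrite raddfB; apply: symbol_spanB.
rewrite word_nerve_sym; case: insubP => [t' _ tE|_]; last exact: symbol_span0.
exists [:: (1, t')]; split; last by rewrite big_seq1 scale1r.
by move=> p; rewrite inE => /eqP -> g gt; apply: tM; rewrite -tE.
Qed.

Lemma symbol_spanE M n (x : nerve G n) :
  symbol_span M x <-> wsupp (word_in M) (nerve_word x).
Proof.
split=> [[s [sM ->]]|xM]; last first.
  by rewrite -[x]nerve_wordK; apply: symbol_span_word_nerve.
rewrite raddf_sum big_seq; apply: wsupp_sum => p /sM pM /=.
rewrite raddfZint /= nerve_word_symbol; apply: wsuppZ.
by apply: wsupp_sym => _ g /pM.
Qed.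

(* Acyclicity of the quotient of the nerve by Omega(G, M), phrased for chains
   of mixed degrees: [wbd x] is a cycle, so it lies in Omega(G, M) as soon as
   it is supported on words in M. *)
Definition relatively_acyclic (M : set G) := forall u, wsupp (word_in M) (wbd u) ->
  exists v, wsupp (word_in M) (u - wbd v).

End NerveWords.

(** * Coacyclicity without Omega *)

Section Coacyclic.
Local Open Scope ring_scope.
Local Open Scope quotient_scope.

Lemma homology_eqP (C : chain_complex) n (z w : cycles C n) :
  \pi_(homology C n) z = \pi_(homology C n) w <->
  exists y : C n.+1, val z - val w = bd C y.
Proof.
rewrite (rwP eqP) -Quotient.idealrBE.
by split=> [/asboolP|zw]; last apply/asboolP.
Qed.

Lemma cycleP (C : chain_complex) n (z : C n.+1) :
  (z \in is_cycle C n.+1) = (bd C z == 0).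
Proof. by []. Qed.

Variables (G : groupType) (M : set G).
Local Notation N := (nerve_complex G).
Local Notation O := (omega_complex M).
Local Notation i := (omega_incl M).

Lemma omegaSP n (x : nerve G n.+1) :
  x \in omega M n.+1 <-> symbol_span M x /\ symbol_span M (nerve_bd x).
Proof. by split=> [/asboolP|?]; last apply/asboolP. Qed.

Lemma symbol_span_nerve0 (x : nerve G 0) : symbol_span M x.
Proof.
elim/nerve_ind: x => [|x y|t _]; [exact: symbol_span0 | exact: symbol_spanB |].
exists [:: (1, t)]; split; last by rewrite big_seq1 scale1r.
by move=> p; rewrite inE => /eqP ->; rewrite tuple0.
Qed.

Lemma omega_span n (x : nerve G n) : x \in omega M n -> symbol_span M x.
Proof. by case: n x => [|n] x /asboolP // []. Qed.

Section ToRelative.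
Hypothesis iso : forall n, bijective (homology_fun i (n := n)).

(** The boundary of [x] is a cycle of Omega that bounds in the nerve. By injectivity it is the
    boundary of some [w] in Omega, and by surjectivity the cycle [x - w] is homologous to a cycle of
    Omega. *)
Lemma coacyclic_split n (x : nerve G n.+1) :
  symbol_span M (nerve_bd x) -> exists y, symbol_span M (x - nerve_bd y).
Proof.
move=> dxM.
have dxO : nerve_bd x \in omega M n.
  case: n x dxM => [|n] x dxM; first exact/asboolP.
  by apply/omegaSP; split=> //; rewrite nerve_bdK; apply: symbol_span0.
pose x' : O n := exist _ (nerve_bd x) dxO.
have dxc : x' \in is_cycle O n.
  rewrite /x'; case: n x dxM dxO @x' => [|n] x dxM dxO //; rewrite cycleP; apply/eqP.
  by apply: val_inj; rewrite /= nerve_bdK.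
pose z : cycles O n := exist _ x' dxc.
have [w wE] : exists w : O n.+1, nerve_bd x = nerve_bd (val w).
  suff /homology_eqP[w] : \pi_(homology O n) z = \pi_(homology O n) 0.
    by rewrite raddf0 addr0 => /(congr1 val) /= wE; exists w.
  apply: (bij_inj (iso n)); rewrite !homology_funE; apply/homology_eqP.
  by exists x; rewrite /= !raddf0 addr0.
have xwc : x - val w \in is_cycle N n.+1.
  by change (nerve_bd (x - val w) == 0); rewrite raddfB /= wE subrr.
pose xw : cycles N n.+1 := exist _ (x - val w) xwc.
have [g _ gK] := iso n.+1; set h := g (\pi_(homology N n.+1) xw).
have : homology_fun i h = \pi_(homology N n.+1) xw by apply: gK.
rewrite -[h]reprK homology_funE => /homology_eqP[y].
rewrite /= => yE; exists (- y); rewrite raddfN opprK /= -yE.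
have -> : x + (val (val (repr h)) - (x - val w)) = val (val (repr h)) - - val w.
  by rewrite opprB addrCA [x + _]addrC subrK opprK.
apply: symbol_spanB; first exact/omega_span/valP.
by rewrite -raddfN; apply/omega_span/valP.
Qed.

End ToRelative.

Lemma relatively_acyclic_cycle n (z : cycles N n) : relatively_acyclic M ->
  exists (w : cycles O n) (y : nerve G n.+1), val z - val (val w) = nerve_bd y.
Proof.
move=> RA; case: n z => [|n] [z zc].
  (* In degree 0 the only word is the empty one, so Omega is the whole nerve. *)
  have zO : z \in omega M 0 by apply/asboolP/symbol_span_nerve0.
  exists (exist _ (exist _ z zO : O 0) isT), 0.
  by rewrite raddf0 /= subrr.
have dz : nerve_bd z = 0 by apply/eqP.
have [|v vM] := RA (nerve_word z).
  by rewrite wbd_nerve_word dz raddf0; apply: wsupp0.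
(* Of the mixed chain [v] only the component whose boundary has the degree of [z] is kept. *)
pose x : nerve G n.+1 := z - nerve_bd (word_nerve n.+2 v).
have dx : nerve_bd x = 0 by rewrite raddfB /= nerve_bdK dz subrr.
have xO : x \in omega M n.+1.
  apply/omegaSP; split; last by rewrite dx; apply: symbol_span0.
  rewrite /x nerve_bd_word_nerve -[z]nerve_wordK -raddfB.
  exact: symbol_span_word_nerve.
pose x' : O n.+1 := exist _ x xO.
have xc : x' \in is_cycle O n.+1.
  by rewrite cycleP; apply/eqP; apply: val_inj.
exists (exist _ x' xc), (word_nerve n.+2 v).
by rewrite /= opprB addrC subrK.
Qed.

Lemma coacyclicP : coacyclic M <-> M 1%g /\ relatively_acyclic M.
Proof.
split=> [[M1 iso]|[M1 RA]]; split=> //.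
  move=> u duM.
  (* The chain [u] has mixed degrees, so each component is corrected separately and the corrections
     are summed up to a bound on the degree. *)
  have YE n : exists y : nerve G n.+1,
      symbol_span M (word_nerve n u - nerve_bd y).
    case: n => [|n]; first by exists 0; apply: symbol_span_nerve0.
    apply: (coacyclic_split iso); rewrite nerve_bd_word_nerve.
    exact: symbol_span_word_nerve.
  pose Y n := projT1 (cid (YE n)); have YM n : symbol_span M (word_nerve n u - nerve_bd (Y n)).
    exact: projT2 (cid (YE n)).
  have [K {1}->] := sum_wproj u.
  exists (\sum_(n < K) nerve_word (Y n)); rewrite raddf_sum -sumrB.
  apply: wsupp_sum => n _.
  by rewrite -word_nerveK /= wbd_nerve_word -raddfB; apply/symbol_spanE.
move=> n.
(* If two cycles of Omega differ by the boundary of [y] in the nerve, then [y] minus a suitable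
   boundary is supported on words in [M] and has the same boundary, so it lies in Omega. *)
have inj : injective (homology_fun i (n := n)).
  move=> h1 h2; rewrite -[h1]reprK -[h2]reprK; set z1 := repr h1; set z2 := repr h2.
  rewrite !homology_funE => /homology_eqP[y] /= yE.
  have zM : symbol_span M (nerve_bd y).
    by rewrite -yE; apply: symbol_spanB; apply/omega_span/valP.
  have [|v vM] := RA (nerve_word y); first by rewrite wbd_nerve_word; apply/symbol_spanE.
  pose x : nerve G n.+1 := y - nerve_bd (word_nerve n.+2 v).
  have dx : nerve_bd x = nerve_bd y by rewrite raddfB /= nerve_bdK subr0.
  have xO : x \in omega M n.+1.
    apply/omegaSP; split; last by rewrite dx.
    by rewrite /x nerve_bd_word_nerve -[y]nerve_wordK -raddfB; apply: symbol_span_word_nerve.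
  apply/homology_eqP; exists (exist _ x xO : O n.+1); apply: val_inj.
  by rewrite raddfB /= dx yE.
have surj (h : homology N n) : exists h', homology_fun i h' = h.
  have [w [y wy]] := relatively_acyclic_cycle (repr h) RA.
  exists (\pi_(homology O n) w); rewrite homology_funE -[h]reprK.
  by apply/homology_eqP; exists (- y); rewrite raddfN /= -wy opprB.
have [g gK] := choice surj.
by exists g => // h; apply: inj; rewrite gK.
Qed.
End Coacyclic.

(** * Contracting the words that are not critical *)

Section Morse.
Local Open Scope ring_scope.
Variables (P : groupType) (comp : P -> option (P * P)) (red : rel P).
Variable Phi : seq P -> nat.
Implicit Types (u w x y z : P) (r s t : seq P) (T : wchain P).

(* [comp w = Some (x, u)] means that w is a reduced product [u * x] whose entry
   is to be cut into x followed by u; [red x y] means that merging the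
   neighbouring entries x, y is the inverse of a cut, and then Phi is preserved. *)
Hypothesis compP : forall w x u, comp w = Some (x, u) ->
  [/\ x != 1%g, u != 1%g, (u * x)%g = w, comp x = None & red x u].
(** This and the next four hypotheses make reducedness local: it depends only on the letters that
    meet, and a reduced product is cut where its right factor would be cut, or just after that
    factor if it is an atom. *)
Hypothesis comp_redl : forall w x u y, comp w = Some (x, u) -> y != 1%g ->
  red u y = red w y.
Hypothesis comp_mull : forall w x u y, comp w = Some (x, u) -> y != 1%g ->
  red w y -> comp (y * w)%g = Some (x, (y * u)%g).
Hypothesis atom_mull : forall w y, comp w = None -> w != 1%g -> y != 1%g ->
  red w y -> comp (y * w)%g = Some (w, y).
Hypothesis atom_redr : forall w y x u, comp w = None -> w != 1%g ->
  comp y = Some (x, u) -> red w x = red w y.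
Hypothesis atom_red_mull : forall w y z, comp w = None -> w != 1%g ->
  y != 1%g -> z != 1%g -> red y z -> red w (z * y)%g = red w y.
Hypothesis red_mul_neq1 : forall x y, x != 1%g -> y != 1%g -> red x y -> (y * x)%g != 1%g.
(** By this and the next three hypotheses, a nondegenerate face keeps [Phi] if it merges a reduced
    pair and lowers it otherwise. The former faces make up [lead_bd]. *)
Hypothesis Phi_behead : forall x t, x != 1%g -> (Phi t < Phi (x :: t))%N.
Hypothesis Phi_belast : forall x s, x != 1%g -> (Phi s < Phi (rcons s x))%N.
Hypothesis Phi_red : forall s x y t, x != 1%g -> y != 1%g -> red x y ->
  Phi (s ++ (y * x)%g :: t) = Phi (s ++ x :: y :: t).
Hypothesis Phi_nred : forall s x y t, x != 1%g -> y != 1%g -> (y * x)%g != 1%g ->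
  ~~ red x y -> (Phi (s ++ (y * x)%g :: t) < Phi (s ++ x :: y :: t))%N.

Lemma word_cons x t : (1%g \notin x :: t) = (x != 1%g) && (1%g \notin t).
Proof. by rewrite inE negb_or eq_sym. Qed.

(* Inserts a bar at the first place where one is possible, if it is missing there. *)
Fixpoint split_bar_word t : wchain P :=
  if t is w :: r then
    if comp w is Some (x, u) then - sym [:: x, u & r]
    else if r is y :: _ then if red w y then 0 else - wcons w (split_bar_word r)
    else 0
  else 0.

Definition split_bar : wchain P -> wchain P := wlin split_bar_word.
HB.instance Definition _ := GRing.Additive.on split_bar.

(* The faces that preserve Phi. *)
Fixpoint lead_bd_word t : wchain P :=
  if t is x :: r then
    if r is y :: r' then
      - (if red x y then sym ((y * x)%g :: r') else 0) - wcons x (lead_bd_word r)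
    else 0
  else 0.

Definition lead_bd : wchain P -> wchain P := wlin lead_bd_word.
HB.instance Definition _ := GRing.Additive.on lead_bd.

Definition atomic t := all (fun w => comp w == None) t.

(** The critical cells of a discrete Morse matching, which pairs a word lacking its first possible
    bar with the same word having that bar. In an atomic word no bar is missing; in a critical one,
    moreover, no present bar could have been inserted. *)
Fixpoint critical t : bool :=
  if t is w :: r then
    [&& comp w == None, if r is y :: _ then ~~ red w y else true & critical r]
  else true.

Lemma split_bar_word_atomic t : atomic t -> split_bar_word t = 0.
Proof.
elim: t => //= w r IHr /andP[/eqP -> /IHr r0].
by case: r r0 {IHr} => // y r ->; rewrite raddf0 oppr0 if_same.
Qed.

Lemma split_bar_atomic T : wsupp atomic T -> split_bar T = 0.
Proof.
apply: (eq_additive_wsupp (F1 := split_bar) (F2 := \0)) => t t1 ta.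
by rewrite /= /split_bar wlin_word // split_bar_word_atomic.
Qed.

Definition head_red w b t : Prop := if t is y :: _ then red w y = b else False.

(** Splitting the tail at most replaces its first entry by the piece cut from it, which meets [w] in
    the same way. So the decision taken at [w] does not depend on whether the tail is split before
    or after. *)
Lemma split_bar_word_head w y r : comp w = None -> w != 1%g ->
  wsupp (head_red w (red w y)) (split_bar_word (y :: r)).
Proof.
move=> wa w1 /=; case cy: (comp y) => [[x u]|].
  by apply/wsuppN/wsupp_sym => _; apply: atom_redr cy.
have hy T : wsupp (head_red w (red w y)) (wcons y T).
  by apply: wsupp_wcons (wsuppT T).
by case: r => [|z r]; [exact: wsupp0 | case: ifP => _; [exact: wsupp0 | exact: wsuppN]].
Qed.

Lemma lead_bd_word_head w y r : comp w = None -> w != 1%g -> 1%g \notin y :: r ->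
  wsupp (head_red w (red w y)) (lead_bd_word (y :: r)).
Proof.
move=> wa w1; rewrite word_cons => /andP[y1]; case: r => [|z r] /=; first by move=> _; exact: wsupp0.
rewrite word_cons => /andP[z1 _]; apply: wsuppB; last by apply: wsupp_wcons (wsuppT _).
apply: wsuppN; case: ifP => yz; last exact: wsupp0.
by apply: wsupp_sym => _; apply: atom_red_mull.
Qed.

Lemma split_bar_wcons_red w T : comp w = None -> w != 1%g ->
  wsupp (head_red w true) T -> split_bar (wcons w T) = 0.
Proof.
move=> wa w1; apply: (eq_additive_wsupp (F1 := split_bar \o wcons w) (F2 := \0)).
move=> [//|y r] yr1 wy; rewrite /= wcons_sym /split_bar wlin_word /= ?wa ?wy //.
by rewrite word_cons w1.
Qed.

Lemma split_bar_wcons_nred w T : comp w = None -> w != 1%g ->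
  wsupp (head_red w false) T -> split_bar (wcons w T) = - wcons w (split_bar T).
Proof.
move=> wa w1; apply: (eq_additive_wsupp (F1 := split_bar \o wcons w)
  (F2 := -%R \o (wcons w \o split_bar))).
move=> [//|y r] yr1 wy; rewrite /= wcons_sym /split_bar !wlin_word //= ?wa ?wy //.
by rewrite word_cons w1.
Qed.

Lemma split_bar_wcons_comp w x u T : comp w = Some (x, u) -> w != 1%g ->
  split_bar (wcons w T) = - wcons x (wcons u T).
Proof.
move=> cw w1; move: T; apply: (eq_additive_word (F1 := split_bar \o wcons w)
  (F2 := -%R \o (wcons x \o wcons u))).
move=> t t1; rewrite /= !wcons_sym /split_bar wlin_word /= ?cw //.
by rewrite word_cons w1.
Qed.

Lemma lead_bd_wcons_nred w T : w != 1%g ->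
  wsupp (head_red w false) T -> lead_bd (wcons w T) = - wcons w (lead_bd T).
Proof.
move=> w1; apply: (eq_additive_wsupp (F1 := lead_bd \o wcons w)
  (F2 := -%R \o (wcons w \o lead_bd))).
move=> [//|y r] yr1 wy; rewrite /= wcons_sym /lead_bd !wlin_word //= ?wy ?oppr0 ?add0r //.
by rewrite word_cons w1.
Qed.

(** On the associated graded of [Phi], inserting the first bar is an exact contraction away from the
    critical words. The induction walks to the first place where a bar is possible. *)
Lemma lead_bd_split_word t : 1%g \notin t -> ~~ critical t ->
  lead_bd (split_bar_word t) + split_bar (lead_bd_word t) = sym t.
Proof.
elim: t => //= w r IHr; rewrite word_cons => /andP[w1 r1].
(* The bar is missing in [w]. Merging [x] and [u] gives the word back; merging [u] and [y] cancels
   against splitting [y * w], which is cut at the same [x]. *)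
case cw: (comp w) => [[x u]|] /= ncr.
  have [x1 u1 uxE xa xu] := compP cw.
  have xur : 1%g \notin [:: x, u & r] by rewrite !word_cons x1 u1.
  rewrite raddfN /= {1}/lead_bd wlin_word //= xu uxE.
  case: r {ncr IHr} r1 xur => [|y r]; first by rewrite !raddf0 !addr0 opprK.
  rewrite word_cons => /andP[y1 r1] xur.
  rewrite (comp_redl cw y1) !raddfB /= (split_bar_wcons_comp _ cw w1).
  case: ifP => wy; last by rewrite !oppr0 !(raddf0 split_bar) !(raddf0 (wcons x)) /=; chain_ring.
  rewrite !(raddfN split_bar, raddfN (wcons x)) /= wcons_sym {1}/split_bar wlin_word /=; last first.
    by rewrite word_cons r1 red_mul_neq1.
  by rewrite (comp_mull cw y1 wy); chain_ring.
case: r ncr IHr r1 => [//|y r] ncr IHr yr1.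
move: (yr1); rewrite word_cons => /andP[y1 r1].
have swr := split_bar_word_head y r cw w1.
have gwr := lead_bd_word_head cw w1 yr1.
(* The bar between [w] and [y] is already present: only the face that removes it contributes, and
   splitting puts it back. The other faces still have this bar, so [split_bar] kills them. *)
case wy: (red w y) ncr swr gwr => /= ncr swr gwr.
  rewrite raddf0 add0r raddfB (raddfN split_bar) /= (split_bar_wcons_red cw w1 gwr).
  rewrite /split_bar wlin_word /=; last by rewrite word_cons r1 red_mul_neq1.
  by rewrite (atom_mull cw w1 y1 wy) opprK subr0.
(* Nothing happens at [w], so both maps anticommute with prefixing [w] and the two signs cancel. *)
rewrite oppr0 add0r (raddfN lead_bd) (raddfN split_bar) /= (lead_bd_wcons_nred w1 swr) (split_bar_wcons_nred cw w1 gwr).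
by rewrite !opprK -raddfD IHr //= wcons_sym.
Qed.

(** The prefix [s] collects the entries already passed: [Phi] is not assumed additive, so they
    cannot be stripped off in the induction. *)
Lemma wsupp_split_bar_word s t : 1%g \notin t ->
  wsupp (fun t' => Phi (s ++ t') = Phi (s ++ t)) (split_bar_word t).
Proof.
elim: t s => [|w r IHr] s /=; first by move=> _; apply: wsupp0.
rewrite word_cons => /andP[w1 r1].
case cw: (comp w) => [[x u]|].
  have [x1 u1 uxE xa xu] := compP cw.
  by apply/wsuppN/wsupp_sym => _; rewrite -uxE Phi_red.
case: r IHr r1 => [|y r] IHr r1; first exact: wsupp0.
case: ifP => _; first exact: wsupp0.
apply: wsuppN; apply: wsupp_wcons (IHr (rcons s w) r1) => t _.
by rewrite !cat_rcons.
Qed.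

(** The sum is a difference in disguise, since [beta_word] enters the boundary with a minus sign.
    What is left are the deletion of the last entry and the merging of unreduced pairs. *)
Lemma wsupp_beta_gr s x t : 1%g \notin x :: t ->
  wsupp (fun t' => Phi (s ++ t') < Phi (s ++ x :: t))%N (beta_word x t + lead_bd_word (x :: t)).
Proof.
elim: t x s => [|y t IHt] x s; rewrite word_cons => /andP[x1 yt1].
  by rewrite /= addr0; apply: wsupp_sym => _; rewrite cats0 cats1 Phi_belast.
have -> : beta_word x (y :: t) + lead_bd_word [:: x, y & t] =
    (if red x y then 0 else sym ((y * x)%g :: t))
    - wcons x (beta_word y t + lead_bd_word (y :: t)).
  by rewrite raddfD /=; case: ifP => _; chain_ring.
apply: wsuppB.
  move: yt1; rewrite word_cons => /andP[y1 t1].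
  case: ifPn => [_|xy]; [exact: wsupp0 | apply: wsupp_sym].
  by rewrite word_cons => /andP[yx1 _]; apply: Phi_nred.
by apply: wsupp_wcons (IHt y (rcons s x) yt1) => r _; rewrite !cat_rcons.
Qed.

Lemma wsupp_bd_gr k T : wsupp (fun t => (Phi t <= k)%N) T ->
  wsupp (fun t => Phi t < k)%N (wbd T - lead_bd T).
Proof.
move: T; apply: (wsupp_hom (F := @wbd P \- lead_bd)) => t t1 tk.
rewrite /= wbd_sym /lead_bd wlin_word //; case: t t1 tk => [|x t] xt1 tk /=.
  by rewrite subrr; apply: wsupp0.
rewrite -addrA -opprD; apply: wsuppB.
  apply: wsupp_sym => _; apply: leq_trans tk; apply: Phi_behead.
  by move: xt1; rewrite word_cons => /andP[].
apply: sub_wsupp (wsupp_beta_gr [::] xt1) => t' /= /leq_trans; exact.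
Qed.

Lemma wsupp_split_bar k T : wsupp (fun t => (Phi t < k)%N) T ->
  wsupp (fun t => Phi t < k)%N (split_bar T).
Proof.
apply: wsupp_hom => t t1 tk; rewrite /= /split_bar wlin_word //.
by apply: sub_wsupp (wsupp_split_bar_word [::] t1) => t' /= ->.
Qed.

Lemma wsupp_split_bar_homotopy k T :
  wsupp (fun t => ~~ critical t /\ (Phi t <= k)%N) T ->
  wsupp (fun t => Phi t < k)%N (T - wbd (split_bar T) - split_bar (wbd T)).
Proof.
move: T; apply: (wsupp_hom (F := (idfun \- (@wbd P \o split_bar)) \- (split_bar \o @wbd P))) => t t1 [nc tk] /=.
have st : wsupp (fun t => (Phi t <= k)%N) (split_bar (sym t)).
  rewrite /split_bar wlin_word //.
  by apply: sub_wsupp (wsupp_split_bar_word [::] t1) => t' /= ->.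
have -> : sym t - wbd (split_bar (sym t)) - split_bar (wbd (sym t)) =
    - (wbd (split_bar (sym t)) - lead_bd (split_bar (sym t))) - split_bar (wbd (sym t) - lead_bd (sym t)).
  have -> : split_bar (sym t) = split_bar_word t by rewrite /split_bar wlin_word.
  have -> : lead_bd (sym t) = lead_bd_word t by rewrite /lead_bd wlin_word.
  by rewrite -{1}(lead_bd_split_word t1 nc) (raddfB split_bar) /=; chain_ring.
apply: wsuppB; first exact/wsuppN/wsupp_bd_gr.
by apply/wsupp_split_bar/wsupp_bd_gr/wsupp_sym.
Qed.

Lemma wsupp_Phi T : exists k, wsupp (fun t => Phi t < k)%N T.
Proof.
elim/wchain_ind: T => [|T1 T2 [k1 T1k] [k2 T2k]|t _].
- by exists 0%N; apply: wsupp0.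
- exists (maxn k1 k2); apply: wsuppB.
    by apply: sub_wsupp T1k => t tk; rewrite leq_max tk.
  by apply: sub_wsupp T2k => t tk; rewrite leq_max tk orbT.
- by exists (Phi t).+1; apply: wsupp_sym.
Qed.

(** The completion of a critical word to a chain with atomic boundary. Its other terms may have the
    same [Phi] as the word; being noncritical, they are removed by the homotopy. *)
Variable om : seq P -> wchain P.
Hypothesis om_leading : forall t, 1%g \notin t -> critical t ->
  wsupp (fun t' => ~~ critical t' /\ (Phi t' <= Phi t)%N) (sym t - om t).
Hypothesis om_bd : forall t, 1%g \notin t -> critical t -> wsupp atomic (wbd (om t)).

Lemma morse T : wsupp atomic (wbd T) ->
  exists c S, wsupp critical c /\ T = wlin om c + wbd S.
Proof.
have [k] := wsupp_Phi T; elim: k T => [|k IHk] T Tk dT.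
  exists 0, 0; split; first exact: wsupp0.
  rewrite !raddf0 addr0.
  exact: (eq_additive_wsupp (F1 := idfun) (F2 := \0)) Tk.
pose cr : {additive wchain P -> wchain P} := wlin (fun t => if critical t then sym t else 0).
have crE t : 1%g \notin t -> cr (sym t) = if critical t then sym t else 0.
  exact: wlin_word.
have crT : wsupp critical (cr T).
  apply: (wsupp_hom (F := cr)) (wsuppT T) => t t1 _; rewrite crE //.
  by case: ifP => ct; [apply: wsupp_sym | apply: wsupp0].
(* This trades the critical words of [T] for noncritical ones of no larger [Phi] and keeps the
   boundary atomic. *)
set T' := T - wlin om (cr T).
have T'k : wsupp (fun t => ~~ critical t /\ (Phi t <= k)%N) T'.
  rewrite {}/T'; move: T Tk {dT crT}; apply: (wsupp_hom (F := idfun \- (wlin om \o cr))) => t t1 tk /=.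
  rewrite crE //; case: ifPn => ct.
    rewrite wlin_word //; apply: sub_wsupp (om_leading t1 ct) => t' [-> t'k].
    by split=> //; exact: (leq_trans t'k tk).
  by rewrite raddf0 subr0; apply: wsupp_sym.
have dT' : wsupp atomic (wbd T').
  rewrite raddfB; apply: wsuppB => //=.
  have := wsupp_hom (F := @wbd P \o wlin om) _ crT; apply=> t t1 ct.
  by rewrite /= wlin_word //; apply: om_bd.
(* [split_bar] vanishes on the atomic boundary of [T'], so subtracting a mere boundary from [T']
   lowers the bound on [Phi]. *)
have := wsupp_split_bar_homotopy T'k; rewrite (split_bar_atomic dT') subr0 => T''k.
have [|c [z [cc T''E]]] := IHk _ T''k; first by rewrite raddfB /= wbdK subr0.
exists (cr T + c), (z + split_bar T'); split; first exact: wsuppD.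
have cE : wlin om c = T' - wbd (split_bar T') - wbd z by rewrite T''E; chain_ring.
rewrite (raddfD (wlin om)) (raddfD (@wbd P)) /= cE -/(wlin om (cr T)).
by rewrite -[T in LHS](subrK (wlin om (cr T))) -/T'; chain_ring.
Qed.

End Morse.

(** * Free products *)

Section FreeProductWords.
Local Open Scope ring_scope.
Variables G G' : groupType.
Local Notation P := (free_product G G').
Local Notation reduced := (@fp_reduced G G').
Local Notation letter0 := (inl 1%g : G + G').
Implicit Types (a b c : seq (G + G')) (u w x y z : P) (s t : seq P).

Lemma fp_reduced_catl a b : reduced (a ++ b) -> reduced a.
Proof.
rewrite /fp_reduced all_cat => /andP[/andP[aN _] /cat_sorted2[aS _]].
by rewrite aN aS.
Qed.

Lemma fp_reduced_catr a b : reduced (a ++ b) -> reduced b.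
Proof.
rewrite /fp_reduced all_cat => /andP[/andP[_ bN] /cat_sorted2[_ bS]].
by rewrite bN bS.
Qed.

(** Being reduced is a condition on single letters and neighbours, so it can be checked on two
    pieces with a nonempty overlap. This is the source of all locality properties below. *)
Lemma fp_reduced_glue a b c : b != [::] ->
  reduced (a ++ b) -> reduced (b ++ c) -> reduced (a ++ b ++ c).
Proof.
case: b => // l b _; rewrite /fp_reduced => /andP[nab sab] /andP[nbc sbc].
move: nab nbc sab; rewrite !all_cat => /andP[-> _] -> /=.
by rewrite !sorted_cat_cons => /andP[-> _].
Qed.

Lemma fp_cat_id a b : reduced (a ++ b) -> fp_cat a b = a ++ b.
Proof.
elim: a => //= l a IHa lab; rewrite IHa ?fp_consK //.
by move: lab; rewrite fp_reduced_cons => /and3P[].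
Qed.

Lemma size_fp_cons_nt l a : (size (fp_cons_nt l a) <= (size a).+1)%N.
Proof. by rewrite /fp_cons_nt; case: ifP. Qed.

Lemma size_fp_cons l a : (size (fp_cons l a) <= (size a).+1)%N.
Proof.
by case: l a => x [|[] y a] /=; rewrite ?(leq_trans (size_fp_cons_nt _ _)).
Qed.

Lemma ltn_size_fp_cons l a : reduced a -> ~~ reduced (l :: a) ->
  (size (fp_cons l a) <= size a)%N.
Proof.
move=> ra; rewrite fp_reduced_cons ra andbT.
have [tl _|ntl] := boolP (fp_trivial l); first by rewrite fp_cons1.
case: a {ra} => // l' a; rewrite /= negbK => ll'.
by case: l l' ll' {ntl} => x [] y //= _; apply: size_fp_cons_nt.
Qed.

Lemma ltn_size_fp_cat a b : reduced a -> reduced b -> ~~ reduced (a ++ b) ->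
  (size (fp_cat a b) < size a + size b)%N.
Proof.
move=> + rb; elim: a => [_|l a IHa rla nr]; first by rewrite /= rb.
have ra : reduced a by move: rla; rewrite fp_reduced_cons => /and3P[].
have [rab|nrab] := boolP (reduced (a ++ b)).
  by rewrite /= fp_cat_id // addSn ltnS -size_cat; apply: ltn_size_fp_cons.
apply: leq_ltn_trans (size_fp_cons _ _) _.
by rewrite addSn ltnS; apply: IHa.
Qed.

Definition fp_elt a : P := insubd (fp_one G G') a.

Lemma val_fp_elt a : reduced a -> val (fp_elt a) = a.
Proof. by move=> ra; rewrite val_insubd ra. Qed.

Lemma fp_eltK w : fp_elt (val w) = w.
Proof. by apply: val_inj; rewrite val_fp_elt //; apply: valP. Qed.

Lemma fp_elt_mul a b : reduced (a ++ b) -> (fp_elt a * fp_elt b)%g = fp_elt (a ++ b).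
Proof.
move=> rab; apply: val_inj; rewrite [LHS]/= !val_fp_elt ?fp_cat_id //.
  exact: fp_reduced_catr rab.
exact: fp_reduced_catl rab.
Qed.

Lemma val_eq_nil w : (val w == [::]) = (w == 1%g).
Proof. by rewrite -val_eqE. Qed.

Definition fp_red : rel P := fun x y => reduced (val y ++ val x).

Lemma val_mul_red x y : fp_red x y -> val (y * x)%g = val y ++ val x.
Proof. exact: fp_cat_id. Qed.

(** Entries are multiplied from right to left, so the last letter of [w] becomes the first of the
    two entries. The default [letter0] is never reached, as [w] has at least two letters. *)
Definition fp_split w : option (P * P) :=
  if (1 < size (val w))%N then
    Some (fp_elt [:: last letter0 (val w)], fp_elt (belast (head letter0 (val w)) (behead (val w))))
  else None.

Lemma fp_split_atomP w : fp_split w = None -> w != 1%g -> exists l, val w = [:: l].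
Proof.
rewrite /fp_split -val_eq_nil; case: (val w) => [|l [|l' v]] //= _ _.
by exists l.
Qed.

Variant fp_split_spec w x u : Prop := FpSplit a l of
  val w = a ++ [:: l] & val u = a & val x = [:: l] & a != [::].

Lemma fp_split_SomeP w x u : fp_split w = Some (x, u) -> fp_split_spec w x u.
Proof.
rewrite /fp_split; case: ifP => // sw [<- <-].
case: w sw => v /= rv; case: v rv => [|l v] //= rv; case/lastP: v rv => [//|v l'] rv _.
rewrite last_rcons belast_rcons /=.
have rv' : reduced ((l :: v) ++ [:: l']) by rewrite cats1.
apply: (@FpSplit _ _ _ (l :: v) l'); rewrite ?val_fp_elt //=.
- by rewrite cats1.
- exact: fp_reduced_catl rv'.
- exact: fp_reduced_catr rv'.
Qed.

Lemma fp_splitE w a l : val w = a ++ [:: l] -> a != [::] ->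
  fp_split w = Some (fp_elt [:: l], fp_elt a).
Proof.
rewrite /fp_split => ->; case: a => //= l' a _.
by rewrite size_cat addn1 /= cats1 last_rcons belast_rcons.
Qed.

Lemma fp_splitP w x u : fp_split w = Some (x, u) ->
  [/\ x != 1%g, u != 1%g, (u * x)%g = w, fp_split x = None & fp_red x u].
Proof.
case/fp_split_SomeP => a l wE uE xE a0.
have rw : reduced (a ++ [:: l]) by rewrite -wE; apply: valP.
split; rewrite -?val_eq_nil ?uE ?xE //.
- by rewrite -[w]fp_eltK wE -fp_elt_mul // -xE -uE !fp_eltK.
- by rewrite /fp_split xE.
- by rewrite /fp_red uE xE.
Qed.

Lemma fp_split_redl w x u y : fp_split w = Some (x, u) -> y != 1%g ->
  fp_red u y = fp_red w y.
Proof.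
case/fp_split_SomeP => a l wE uE xE a0 y1; rewrite /fp_red uE wE.
have rw : reduced (a ++ [:: l]) by rewrite -wE; apply: valP.
apply/idP/idP => [ya|]; first exact: fp_reduced_glue.
by rewrite catA; apply: fp_reduced_catl.
Qed.

Lemma fp_split_mull w x u y : fp_split w = Some (x, u) -> y != 1%g ->
  fp_red w y -> fp_split (y * w)%g = Some (x, (y * u)%g).
Proof.
move=> sw y1 wy; have uy := wy; rewrite -(fp_split_redl sw y1) in uy.
case/fp_split_SomeP: sw => a l wE uE xE a0.
rewrite (@fp_splitE _ (val (y * u)%g) l); first by rewrite -xE !fp_eltK.
  by rewrite !val_mul_red // wE uE catA.
by rewrite val_mul_red // uE; case: (val y).
Qed.

Lemma fp_atom_mull w y : fp_split w = None -> w != 1%g -> y != 1%g ->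
  fp_red w y -> fp_split (y * w)%g = Some (w, y).
Proof.
move=> wa w1 y1 wy; have [l wE] := fp_split_atomP wa w1.
rewrite (@fp_splitE _ (val y) l); first by rewrite -wE !fp_eltK.
  by rewrite val_mul_red // wE.
by rewrite val_eq_nil.
Qed.

Lemma fp_atom_redr w y x u : fp_split w = None -> w != 1%g ->
  fp_split y = Some (x, u) -> fp_red w x = fp_red w y.
Proof.
move=> wa w1 /fp_split_SomeP[a l yE uE xE a0]; rewrite /fp_red xE yE.
have ry : reduced (a ++ [:: l]) by rewrite -yE; apply: valP.
apply/idP/idP => [lw|]; first by rewrite -catA; apply: fp_reduced_glue.
by rewrite -catA; apply: fp_reduced_catr.
Qed.

Lemma fp_red_mull w y z : y != 1%g -> fp_red y z -> fp_red w (z * y)%g = fp_red w y.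
Proof.
move=> y1 yz; rewrite /fp_red val_mul_red //.
apply/idP/idP => [|yw]; first by rewrite -catA; apply: fp_reduced_catr.
by rewrite -catA; apply: fp_reduced_glue; rewrite ?val_eq_nil.
Qed.

Lemma fp_red_mul_neq1 x y : y != 1%g -> fp_red x y -> (y * x)%g != 1%g.
Proof.
by move=> y1 xy; rewrite -!val_eq_nil in y1 *; rewrite val_mul_red //; case: (val y) y1.
Qed.

Definition fp_size t := sumn [seq size (val w) | w <- t].

Lemma size_val_gt0 w : w != 1%g -> (0 < size (val w))%N.
Proof. by rewrite -val_eq_nil; case: (val w). Qed.

Lemma fp_size_behead x t : x != 1%g -> (fp_size t < fp_size (x :: t))%N.
Proof. by move=> /size_val_gt0; rewrite /fp_size /=; lia. Qed.

Lemma fp_size_belast x s : x != 1%g -> (fp_size s < fp_size (rcons s x))%N.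
Proof. by move=> /size_val_gt0; rewrite /fp_size map_rcons sumn_rcons; lia. Qed.

Lemma fp_size_red s x y t : fp_red x y ->
  fp_size (s ++ (y * x)%g :: t) = fp_size (s ++ x :: y :: t).
Proof.
move=> xy; have := congr1 size (val_mul_red xy).
by rewrite size_cat /fp_size !map_cat !sumn_cat /=; lia.
Qed.

Lemma fp_size_nred s x y t : ~~ fp_red x y ->
  (fp_size (s ++ (y * x)%g :: t) < fp_size (s ++ x :: y :: t))%N.
Proof.
move=> xy; have := ltn_size_fp_cat (valP y) (valP x) xy.
by rewrite /fp_size !map_cat !sumn_cat /=; lia.
Qed.

Lemma fp_letterP w l : val w = [:: l] ->
  w = match l with inl a => fp_inl G' a | inr a => fp_inr G a end.
Proof.
move=> wE; have : reduced (val w) by apply: valP.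
rewrite wE fp_reduced_cons => /andP[nl _]; apply: val_inj; rewrite wE.
by case: l nl {wE} => a /= /negbTE na; rewrite /fp_cons_nt /= na.
Qed.

(** Each entry is a single letter, and two neighbouring letters from different factors would form a
    reduced pair. *)
Lemma fp_critical_pure t : 1%g \notin t -> critical fp_split fp_red t ->
  (exists s : seq G, t = map (@fp_inl G G') s) \/
  (exists s : seq G', t = map (@fp_inr G G') s).
Proof.
elim: t => [|w t IHt]; first by left; exists [::].
rewrite word_cons => /andP[w1 t1] /= /and3P[/eqP wa wt ct].
have [l wl] := fp_split_atomP wa w1; have wE := fp_letterP wl.
have rw : reduced (val w) by apply: valP.
case: t IHt t1 wt ct => [|y t] IHt yt1 wy cyt.
  by case: l wE {wl} => a ->; [left | right]; exists [:: a].
move: (yt1); rewrite word_cons => /andP[y1 _].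
move: cyt (cyt) => /= /andP[/eqP ya _] cyt.
have [l' yl] := fp_split_atomP ya y1; have yE := fp_letterP yl.
have ry : reduced (val y) by apply: valP.
have ll' : fp_same l' l.
  apply: contraNT wy => nll'; move: ry rw; rewrite /fp_red yl wl /=.
  by rewrite !fp_reduced_cons nll' => /andP[-> _] /andP[->].
case: (IHt yt1 cyt) => -[[|b s] // [yb tE]].
  case: l ll' wE {wl rw} => a ll' wE; first by left; exists [:: a, b & s]; rewrite wE yb tE.
  case: l' yl yE ll' {ry} => // b' yl yE _.
  by move: yl y1; rewrite yb -val_eq_nil /= /fp_cons_nt; case: ifP.
case: l ll' wE {wl rw} => a ll' wE; last by right; exists [:: a, b & s]; rewrite wE yb tE.
case: l' yl yE ll' {ry} => // b' yl yE _.
by move: yl y1; rewrite yb -val_eq_nil /= /fp_cons_nt; case: ifP.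
Qed.

End FreeProductWords.

(** * Relative acyclicity for the free product *)

Section FreeProductAcyclic.
Local Open Scope ring_scope.

Definition const1 (A B : groupType) (a : A) : B := 1%g.
Fact const1M (A B : groupType) : {morph @const1 A B : x y / (x * y)%g}.
Proof. by move=> x y; rewrite /const1 mulg1. Qed.
HB.instance Definition _ (A B : groupType) :=
  isMultiplicative.Build A B (@const1 A B) (@const1M A B).

Lemma fp_proj_exist (G G' K : groupType) (f : {multiplicative G -> K})
    (f' : {multiplicative G' -> K}) :
  exists h : free_product G G' -> K, [/\ {morph h : s t / (s * t)%g},
    h 1%g = 1%g, forall a, h (fp_inl G' a) = f a & forall a, h (fp_inr G a) = f' a].
Proof.
have [h [hM hl hr] _] := free_product_univ f f'.
by exists h; split=> [//||a|a]; [apply: (mulgI (h 1%g)); rewrite -hM !mulg1 | exact: hl | exact: hr].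
Qed.

Variables (G G' : groupType) (M : set G) (M' : set G').
Local Notation P := (free_product G G').
Local Notation S := ((@fp_inl G G' @` M) `|` (@fp_inr G G' @` M'))%classic.
Local Notation inl_ := (@fp_inl G G').
Local Notation inr_ := (@fp_inr G G').

Lemma fp_inl_atomic a : fp_split (inl_ a) = None.
Proof. by rewrite /fp_split ltnNge (size_fp_cons_nt _ [::]). Qed.

Lemma fp_inr_atomic a : fp_split (inr_ a) = None.
Proof. by rewrite /fp_split ltnNge (size_fp_cons_nt _ [::]). Qed.

(** Critical words need no completion: they come from one factor, so their boundary does too, and
    elements of a factor have at most one letter. *)
Lemma fp_morse (T : wchain P) : wsupp (atomic (@fp_split G G')) (wbd T) ->
  exists c z, wsupp (critical (@fp_split G G') (@fp_red G G')) c /\ T = c + wbd z.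
Proof.
move=> dT.
have [|||||||||||||c [z [cc TE]]] := @morse _ (@fp_split G G') (@fp_red G G') (@fp_size G G')
   _ _ _ _ _ _ _ _ _ _ _ (@sym P) _ _ T dT.
- exact: fp_splitP.
- exact: fp_split_redl.
- exact: fp_split_mull.
- exact: fp_atom_mull.
- exact: fp_atom_redr.
- by move=> w y z _ _ y1 _ yz; apply: fp_red_mull.
- by move=> x y _ y1; apply: fp_red_mul_neq1.
- exact: fp_size_behead.
- exact: fp_size_belast.
- by move=> s x y t _ _; apply: fp_size_red.
- by move=> s x y t _ _ _; apply: fp_size_nred.
- by move=> t _ _; rewrite subrr; apply: wsupp0.
- move=> t t1 ct; case: (fp_critical_pure t1 ct) => -[s ->].
    rewrite -wmap_sym ?fp_inl1 // wbd_wmap ?fp_inl1 //; last exact: fp_inlM.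
    apply: wsupp_hom (wsuppT _) => r _ _; rewrite /= wmap_sym ?fp_inl1 //.
    by apply: wsupp_sym => _; rewrite /atomic all_map; apply/allP => a _ /=; rewrite fp_inl_atomic.
  rewrite -wmap_sym ?fp_inr1 // wbd_wmap ?fp_inr1 //; last exact: fp_inrM.
  apply: wsupp_hom (wsuppT _) => r _ _; rewrite /= wmap_sym ?fp_inr1 //.
  by apply: wsupp_sym => _; rewrite /atomic all_map; apply/allP => a _ /=; rewrite fp_inr_atomic.
exists c, z; split=> //; rewrite TE; congr (_ + _).
move: c {cc TE}; apply: (eq_additive_word (F1 := wlin (@sym P)) (F2 := idfun)) => t t1.
by rewrite /= wlin_word.
Qed.

Lemma relatively_acyclic_free_product :
  relatively_acyclic M -> relatively_acyclic M' -> relatively_acyclic S.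
Proof.
move=> RA RA' T dTS.
have [|c [z [cc TE]]] := fp_morse (T := T).
  apply: sub_wsupp dTS => t tS; apply/allP => w /tS[] [a _ <-].
    by rewrite fp_inl_atomic.
  by rewrite fp_inr_atomic.
have dc : wbd c = wbd T by rewrite TE raddfD /= wbdK addr0.
have [p [pM p1 pl pr]] := fp_proj_exist (@idfun G) (@const1 G' G).
have [p' [p'M p'1 p'l p'r]] := fp_proj_exist (@const1 G G') (@idfun G').
(* In the boundary of [c] all entries come from [M] or [M']. Under [p] the latter become 1, so a
   word containing one of them becomes degenerate. *)
have [|y yM] := RA (wmap p c).
  rewrite wbd_wmap // dc; apply: wsupp_hom dTS => t _ tS.
  rewrite /= wmap_sym //; apply: wsupp_sym => t1 g gt.
  case/mapP: (gt) => w /tS[] [a Ma <-] gE; first by rewrite gE pl.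
  by case/negP: t1; rewrite -[1%g](pr a) -gE.
have [|y' y'M] := RA' (wmap p' c).
  rewrite wbd_wmap // dc; apply: wsupp_hom dTS => t _ tS.
  rewrite /= wmap_sym //; apply: wsupp_sym => t1 g gt.
  case/mapP: (gt) => w /tS[] [a Ma <-] gE; last by rewrite gE p'r.
  by case/negP: t1; rewrite -[1%g](p'l a) -gE.
have l1 := @fp_inl1 G G'; have r1 := @fp_inr1 G G'.
have lM := @fp_inlM G G'; have rM := @fp_inrM G G'.
exists (z + wmap inl_ y + wmap inr_ y').
have -> : T - wbd (z + wmap inl_ y + wmap inr_ y') =
    (c - wmap inl_ (wmap p c) - wmap inr_ (wmap p' c))
    + wmap inl_ (wmap p c - wbd y) + wmap inr_ (wmap p' c - wbd y').
  rewrite TE !raddfD !raddfN /= !wbd_wmap //; chain_ring.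
apply: wsuppD; first apply: wsuppD.
- move: c cc {TE dc yM y'M}; apply: (wsupp_hom
    (F := (idfun \- (wmap inl_ \o wmap p)) \- (wmap inr_ \o wmap p'))) => t t1 ct.
  rewrite /= !wmap_sym //.
  (* A nonempty word of one factor is killed by the projection to the other. The empty word survives
     both projections and is subtracted once too often, but it is vacuously a word in [S]. *)
  have sym_const1 (A : Type) (s : seq A) : wsupp (word_in S) (sym (map (fun=> 1%g : P) s)).
    case: s => [|a s]; first exact: wsupp_sym.
    by rewrite sym0 ?mem_head //; apply: wsupp0.
  have [[s ->]|[s ->]] := fp_critical_pure t1 ct.
    have -> : map inl_ (map p (map inl_ s)) = map inl_ s.
      by rewrite -!map_comp; apply: eq_map => a /=; rewrite pl.
    have -> : map inr_ (map p' (map inl_ s)) = map (fun=> 1%g) s.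
      by rewrite -!map_comp; apply: eq_map => a /=; rewrite p'l.
    by rewrite subrr sub0r; apply: wsuppN.
  have -> : map inr_ (map p' (map inr_ s)) = map inr_ s.
    by rewrite -!map_comp; apply: eq_map => a /=; rewrite p'r.
  have -> : map inl_ (map p (map inr_ s)) = map (fun=> 1%g) s.
    by rewrite -!map_comp; apply: eq_map => a /=; rewrite pr.
  by rewrite addrAC subrr sub0r; apply: wsuppN.
- apply: wsupp_hom yM => t _ tM; rewrite /= wmap_sym //.
  by apply: wsupp_sym => _ _ /mapP[a /tM Ma ->]; left; exists a.
- apply: wsupp_hom y'M => t _ tM; rewrite /= wmap_sym //.
  by apply: wsupp_sym => _ _ /mapP[a /tM Ma ->]; right; exists a.
Qed.

End FreeProductAcyclic.

(** * Pure subgroups *)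

Section PureSubgroup.
Local Open Scope ring_scope.
Variables (T : choiceType) (X : {freeg T} -> Prop).
Hypothesis X0 : X 0.
Hypothesis XB : forall x y, X x -> X y -> X (x - y).
Hypothesis X_pure : forall (n : int) x, n != 0 -> X (n *: x) -> X x.

(* Write the coefficient matrix of [vs] in Smith normal form L D R. By purity
   the rows of R with a nonzero diagonal entry lie in X, and the projection
   onto their span along the remaining rows of R is the identity on [vs]. *)
Lemma pure_retraction (vs : seq {freeg T}) : (forall v, v \in vs -> X v) ->
  exists rho : {additive {freeg T} -> {freeg T}},
    (forall v, X (rho v)) /\ (forall v, v \in vs -> rho v = v).
Proof.
move=> vsX.
have XD x y : X x -> X y -> X (x + y).
  by move=> Xx Xy; rewrite -[y]opprK; apply: XB => //; rewrite -sub0r; apply: XB.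
have XZ (n : int) x : X x -> X (n *: x).
  move=> Xx; have XMn k : X (x *+ k) by elim: k => [|k IH]; rewrite ?mulr0n // mulrS; apply: XD.
  by rewrite -[n]intz scaler_int; case: n => k; [exact: XMn | rewrite NegzE mulrNz -sub0r; apply: XB => //; exact: XMn].
pose ts := undup (flatten [seq dom v | v <- vs]).
pose m := size vs; pose n := size ts.
pose e (r : 'rV[int]_n) : {freeg T} := \sum_(j < n) r 0 j *: << tnth (in_tuple ts) j >>.
pose c (v : {freeg T}) : 'rV[int]_n := \row_j coeff (tnth (in_tuple ts) j) v.
have eD r r' : e (r - r') = e r - e r'.
  by rewrite /e -sumrB; apply: eq_bigr => j _; rewrite !mxE scalerBl.
have eS p (a : 'rV[int]_p) (M : 'M_(p, n)) : e (a *m M) = \sum_i a 0 i *: e (row i M).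
  rewrite /e; under [RHS]eq_bigr => i _ do rewrite scaler_sumr.
  rewrite exchange_big /=; apply: eq_bigr => j _.
  rewrite !mxE scaler_suml; apply: eq_bigr => i _.
  by rewrite !mxE scalerA.
have ce v : v \in vs -> e (c v) = v.
  move=> vvs; apply/eqP/freeg_eqP => t; rewrite /e raddf_sum /=.
  under eq_bigr => j _ do rewrite mxE coeffZ coeffU mul1r.
  have [tts|tts] := boolP (t \in ts); last first.
    rewrite big1 => [|j _]; last first.
      case: eqP => [jt|_]; last by rewrite mulr0.
      by case/negP: tts; rewrite -jt mem_tnth.
    rewrite coeff_outdom //; apply: contra tts => tv.
    by rewrite mem_undup; apply/flattenP; exists (dom v) => //; apply: map_f.
  have [j ->] : exists j, t = tnth (in_tuple ts) j by apply/tnthP.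
  rewrite (bigD1 j) //= eqxx mulr1 big1 ?addr0 // => i ij.
  case: eqP => [/eqP|_]; last by rewrite mulr0.
  rewrite !(tnth_nth t) /= nth_uniq ?undup_uniq // => /eqP/val_inj ijE.
  by rewrite ijE eqxx in ij.
pose V : 'M[int]_(m, n) := \matrix_(i, j) coeff (tnth (in_tuple ts) j) (tnth (in_tuple vs) i).
have rowV i : e (row i V) = tnth (in_tuple vs) i.
  rewrite -[RHS]ce ?mem_tnth //; congr e; apply/rowP => j; by rewrite !mxE.
have [L Lu [R Ru [d _ VE]]] := int_Smith_normal_form V.
set D := (\matrix_(i, j) _) in VE.
pose E : 'M[int]_n := \matrix_(i, j) (((i < m)%N && (d`_i != 0)) && (i == j))%:R.
have DE : D *m E = D.
  apply/matrixP => i j; rewrite !mxE; have [in_|ni] := ltnP i n.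
    rewrite (bigD1 (Ordinal in_)) //= !mxE eqxx mulr1n big1 ?addr0 => [|k ki]; last first.
      rewrite !mxE; case: eqP => [ik|_]; last by rewrite mulr0n mul0r.
      by case/eqP: ki; apply: val_inj.
    rewrite (ltn_ord i : (Ordinal in_ < m)%N) /=; have [->|_] := eqVneq d`_i 0; first by rewrite mul0r mul0rn.
    by rewrite -val_eqE /=; case: eqP; rewrite ?mulr1 ?mulr0.
  rewrite big1 => [|k _]; last first.
    by rewrite !mxE; case: eqP => [ik|_]; [have := ltn_ord k; lia | rewrite mulr0n mul0r].
  by case: eqP => [ij|_]; [have := ltn_ord j; lia | rewrite mulr0n].
(* Forget the basis elements outside [ts], pass to coordinates in the rows of [R], keep those with
   nonzero diagonal entry, and return. *)
pose rho v := e (c v *m invmx R *m E *m R).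
have rhoB : zmod_morphism rho.
  move=> v w; rewrite /rho -eD -!mulmxBl.
  have -> // : c (v - w) = c v - c w by apply/rowP => j; rewrite !mxE coeffB.
pose rho_mixin := GRing.isZmodMorphism.Build _ _ rho rhoB.
pose rho' : {additive {freeg T} -> {freeg T}} := HB.pack rho rho_mixin.
exists rho'; split=> [v|v vvs]; rewrite /= /rho.
  rewrite -mulmxA eS; elim/big_rec: _ => // i x _ Xx; apply: (XD _ _ _ Xx); apply: (XZ).
  have [|nz] := boolP ((i < m)%N && (d`_i != 0)); last first.
    have -> : row i (E *m R) = 0.
      by apply/rowP => j; rewrite !mxE big1 // => k _; rewrite !mxE (negbTE nz) mul0r.
    have -> : e 0 = 0 by rewrite /e big1 // => j _; rewrite mxE scale0r.
    exact: X0.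
  case/andP=> im di; have rE : row i (E *m R) = row i R.
    apply/rowP => j; rewrite !mxE (bigD1 i) //= !mxE im di eqxx mul1r big1 ?addr0 // => k ki.
    by rewrite !mxE [i == k]eq_sym (negbTE ki) andbF mul0r.
  rewrite rE; apply: (X_pure di).
  have -> : d`_i *: e (row i R) = e (row (Ordinal im) (D *m R)).
    rewrite /e scaler_sumr; apply: eq_bigr => j _; rewrite scalerA !mxE; congr (_ *: _).
    rewrite (bigD1 i) //= !mxE eqxx mulr1n big1 ?addr0 // => k ki.
    have ki' : (i == k :> nat) = false by rewrite eq_sym val_eqE; apply/negbTE.
    by rewrite !mxE /= ki' mulr0n mul0r.
  (* [L] is invertible over the integers, so the rows of [D R] are integral combinations of [vs] and
     lie in [X]. *)
  have -> : D *m R = invmx L *m V by rewrite VE -mulmxA mulKmx.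
  rewrite row_mul eS; elim/big_rec: _ => // k y _ Xy; apply: (XD _ _ _ Xy); apply: (XZ).
  by rewrite rowV; apply/vsX/mem_tnth.
have [i ->] : exists i, v = tnth (in_tuple vs) i by apply/tnthP.
have -> : c (tnth (in_tuple vs) i) = row i V by apply/rowP => j; rewrite !mxE.
rewrite -rowV; congr e; rewrite -!row_mul; congr (row i _).
(* With V = L D R, cancelling R leaves L D E R, which is L D R since D E = D. *)
by rewrite {1}VE mulmxK // -(mulmxA L) DE -VE.
Qed.

End PureSubgroup.

(** * The tensor product of two nerves *)

Section Sign.
Local Open Scope ring_scope.
Variable P : groupType.
Implicit Types (u v : wchain P).

(** The Koszul sign for moving the differential past the left factor of a tensor product. *)
Definition wsgn : wchain P -> wchain P :=
  wlin (fun s => (-1) ^+ size s *: sym s).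
HB.instance Definition _ := GRing.Additive.on wsgn.

Lemma wsgn_sym (s : seq P) : wsgn (sym s) = (-1) ^+ size s *: sym s.
Proof. by rewrite /wsgn wlin_sym // => s1; rewrite sym0 // scaler0. Qed.

Lemma wsupp_wsgn (Q : seq P -> Prop) u : wsupp Q u -> wsupp Q (wsgn u).
Proof. by apply: wsupp_hom => s _ Qs; rewrite /= wsgn_sym; apply/wsuppZ/wsupp_sym. Qed.

Lemma wsgn_deg n (u : wchain P) : wsupp (@deg_is P n) u -> wsgn u = (-1) ^+ n *: u.
Proof.
move: u; apply: wsupp_ind => [|u v uE vE|s _ sn]; first by rewrite raddf0 scaler0.
  by rewrite raddfB /= uE vE scalerBr.
by rewrite wsgn_sym sn.
Qed.

Lemma wbd_wsgn (u : wchain P) : wbd (wsgn u) = - wsgn (wbd u).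
Proof.
elim/wchain_ind: u => [|u v uE vE|s _]; first by rewrite !raddf0.
  by rewrite !raddfB /= uE vE.
rewrite wsgn_sym raddfZint /= wbd_sym; have := wsupp_bd_word s.
case: s => [|a s] sz; first by rewrite scaler0 raddf0 oppr0.
by rewrite (wsgn_deg sz) /= exprS mulN1r scaleNr.
Qed.

End Sign.

Section Bicomplex.
Local Open Scope ring_scope.
Variables G G' : groupType.
Implicit Types (s : seq G) (t : seq G') (x : wchain G) (y : wchain G').

(** The tensor product of the two word complexes, given by its basis of pairs of words. *)
Definition bichain := {freeg (word G * word G')}.
HB.instance Definition _ := GRing.Lmodule.on bichain.
Implicit Type k : bichain.

Definition ksupp (Q : seq G -> seq G' -> Prop) : bichain -> Prop :=
  supp (fun ab => Q (val ab.1) (val ab.2)).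

Lemma ksupp0 Q : ksupp Q 0.
Proof. exact: supp0. Qed.

Lemma ksuppB Q k1 k2 : ksupp Q k1 -> ksupp Q k2 -> ksupp Q (k1 - k2).
Proof. exact: suppB. Qed.

Lemma ksuppD Q k1 k2 : ksupp Q k1 -> ksupp Q k2 -> ksupp Q (k1 + k2).
Proof. exact: suppD. Qed.

Lemma ksuppZ Q (n : int) k : ksupp Q k -> ksupp Q (n *: k).
Proof. exact: suppZ. Qed.

Lemma ksupp_sum Q (I : Type) (r : seq I) (p : pred I) (F : I -> bichain) :
  (forall i, p i -> ksupp Q (F i)) -> ksupp Q (\sum_(i <- r | p i) F i).
Proof. exact: supp_sum. Qed.

Lemma sub_ksupp (Q R : seq G -> seq G' -> Prop) k :
  (forall s t, Q s t -> R s t) -> ksupp Q k -> ksupp R k.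
Proof. by move=> QR; apply: sub_supp => ab /QR. Qed.

Lemma ksuppI (Q R : seq G -> seq G' -> Prop) k :
  ksupp Q k -> ksupp R k -> ksupp (fun s t => Q s t /\ R s t) k.
Proof. by move=> kQ kR; split=> ab nz; split; [apply: (suppP kQ) | apply: (suppP kR)]. Qed.

Definition tens x y : bichain :=
  lin (fun a => lin (fun b => << (a, b) >> : bichain) y) x.
(** The arguments are flipped so that additivity in the left factor can be registered as an
    instance. *)
Definition tensl y x : bichain := tens x y.

Fact tens_is_additive x : zmod_morphism (tens x).
Proof.
move=> y y'; pose F z a := lin (fun b : word G' => << (a, b) >> : bichain) z.
apply: (eq_additive_supp (Q := fun=> True) (F1 := lin (F (y - y')))
  (F2 := lin (F y) \- lin (F y'))) => // a _.
by rewrite /= !linU /F raddfB.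
Qed.
HB.instance Definition _ x :=
  GRing.isZmodMorphism.Build (wchain G') bichain (tens x) (tens_is_additive x).

Fact tensl_is_additive y : zmod_morphism (tensl y).
Proof. by move=> x x'; rewrite /tensl /tens raddfB. Qed.
HB.instance Definition _ y :=
  GRing.isZmodMorphism.Build (wchain G) bichain (tensl y) (tensl_is_additive y).

Lemma tensBl x x' y : tens (x - x') y = tens x y - tens x' y.
Proof. exact: (raddfB (tensl y)). Qed.
Lemma tensBr x y y' : tens x (y - y') = tens x y - tens x y'.
Proof. exact: raddfB. Qed.
Lemma tens0l y : tens 0 y = 0.
Proof. exact: (raddf0 (tensl y)). Qed.
Lemma tens0r x : tens x 0 = 0.
Proof. exact: raddf0. Qed.
Lemma tensNl x y : tens (- x) y = - tens x y.
Proof. exact: (raddfN (tensl y)). Qed.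
Lemma tensZl (n : int) x y : tens (n *: x) y = n *: tens x y.
Proof. exact: (raddfZint (tensl y)). Qed.
Lemma tensU (a : word G) (b : word G') : tens << a >> << b >> = << (a, b) >>.
Proof. by rewrite /tens !linU. Qed.

Lemma ksupp_ind Q (C : bichain -> Prop) :
    C 0 -> (forall k1 k2, C k1 -> C k2 -> C (k1 - k2)) ->
    (forall s t, 1%g \notin s -> 1%g \notin t -> Q s t -> C (tens (sym s) (sym t))) ->
  forall k, ksupp Q k -> C k.
Proof.
move=> C0 CB CT; apply: supp_ind => // -[a b] Qab.
rewrite -tensU -!sym_val; apply: CT => //; [exact: (valP a) | exact: (valP b)].
Qed.

Lemma bichain_ind (C : bichain -> Prop) :
    C 0 -> (forall k1 k2, C k1 -> C k2 -> C (k1 - k2)) ->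
    (forall s t, 1%g \notin s -> 1%g \notin t -> C (tens (sym s) (sym t))) ->
  forall k, C k.
Proof. by move=> C0 CB CT k; apply: (@ksupp_ind (fun _ _ => True)) => // s t s1 t1 _; apply: CT. Qed.

Lemma ksupp_tens (Q : seq G -> Prop) (R : seq G' -> Prop) (S : seq G -> seq G' -> Prop) x y :
  (forall s t, Q s -> R t -> S s t) -> wsupp Q x -> wsupp R y -> ksupp S (tens x y).
Proof.
move=> QRS xQ yR; move: x xQ; apply: wsupp_ind => [|x x' xE x'E|s s1 Qs].
- by rewrite tens0l; apply: ksupp0.
- by rewrite tensBl; apply: ksuppB.
move: y yR; apply: wsupp_ind => [|y y' yE y'E|t t1 Rt].
- by rewrite tens0r; apply: ksupp0.
- by rewrite tensBr; apply: ksuppB.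
rewrite /sym; case: insubP => [a _ aE|]; last by move=> _; rewrite tens0l; apply: ksupp0.
case: insubP => [b _ bE|]; last by move=> _; rewrite tens0r; apply: ksupp0.
by rewrite tensU; apply: suppU; rewrite /= aE bE; apply: QRS.
Qed.

Definition klin (V : lmodType int) (f : seq G -> seq G' -> V) : bichain -> V :=
  lin (fun ab => f (val ab.1) (val ab.2)).
HB.instance Definition _ (V : lmodType int) (f : seq G -> seq G' -> V) :=
  GRing.Additive.on (klin f).

Lemma klin_tens (V : lmodType int) (f : seq G -> seq G' -> V) s t :
  1%g \notin s -> 1%g \notin t -> klin f (tens (sym s) (sym t)) = f s t.
Proof.
rewrite /sym; case: insubP => [a _ <- _|/negP//].
by case: insubP => [b _ <- _|/negP//]; rewrite tensU /klin linU.
Qed.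

Definition dh : bichain -> bichain := klin (fun s t => tens (bd_word s) (sym t)).
HB.instance Definition _ := GRing.Additive.on dh.
Definition dv : bichain -> bichain := klin (fun s t => tens (wsgn (sym s)) (bd_word t)).
HB.instance Definition _ := GRing.Additive.on dv.

Lemma dh_tens x y : dh (tens x y) = tens (wbd x) y.
Proof.
elim/wchain_ind: x => [|x x' xE x'E|s s1]; first by rewrite !(tens0l, raddf0).
  by rewrite raddfB /= !tensBl raddfB /= xE x'E.
elim/wchain_ind: y => [|y y' yE y'E|t t1]; first by rewrite !(tens0r, raddf0).
  by rewrite !tensBr raddfB /= yE y'E.
by rewrite /dh klin_tens // wbd_sym.
Qed.

Lemma dv_tens x y : dv (tens x y) = tens (wsgn x) (wbd y).
Proof.
elim/wchain_ind: x => [|x x' xE x'E|s s1]; first by rewrite !(tens0l, raddf0).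
  by rewrite raddfB /= !tensBl raddfB /= xE x'E.
elim/wchain_ind: y => [|y y' yE y'E|t t1]; first by rewrite !(tens0r, raddf0).
  by rewrite (raddfB (@wbd G')) !tensBr raddfB /= yE y'E.
by rewrite /dv klin_tens // wbd_sym.
Qed.

Definition kbd : bichain -> bichain := dh \+ dv.
HB.instance Definition _ := GRing.Additive.on kbd.

Lemma kbd_tens x y : kbd (tens x y) = tens (wbd x) y + tens (wsgn x) (wbd y).
Proof. by rewrite /kbd /= dh_tens dv_tens. Qed.

Lemma kbdK k : kbd (kbd k) = 0.
Proof.
elim/bichain_ind: k => [|k k' kE k'E|s t _ _]; first by rewrite !raddf0.
  by rewrite !raddfB /= kE k'E subrr.
rewrite kbd_tens raddfD /= !kbd_tens !wbdK tens0l tens0r addr0 add0r wbd_wsgn.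
by rewrite tensNl addrN.
Qed.

(** The coefficient of [b] when a bichain is expanded over right words, as a chain on the left;
    [birow] does the same with the sides exchanged. *)
Definition bicol (b : word G') : bichain -> wchain G :=
  lin (fun ab => if ab.2 == b then << ab.1 >> : wchain G else 0).
HB.instance Definition _ b := GRing.Additive.on (bicol b).
Definition birow (a : word G) : bichain -> wchain G' :=
  lin (fun ab => if ab.1 == a then << ab.2 >> : wchain G' else 0).
HB.instance Definition _ a := GRing.Additive.on (birow a).

Lemma col_tens b x (b' : word G') : bicol b (tens x << b' >>) = if b' == b then x else 0.
Proof.
elim/freeg_ind: x => [|x x' xE x'E|a].
- by rewrite tens0l raddf0 if_same.
- by rewrite tensBl raddfB /= xE x'E; case: ifP; rewrite ?subrr.
- by rewrite tensU /bicol linU.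
Qed.

Lemma row_tens a (a' : word G) y : birow a (tens << a' >> y) = if a' == a then y else 0.
Proof.
elim/freeg_ind: y => [|y y' yE y'E|b].
- by rewrite tens0r raddf0 if_same.
- by rewrite tensBr raddfB /= yE y'E; case: ifP; rewrite ?subrr.
- by rewrite tensU /birow linU.
Qed.

Lemma wsupp_col (Q : seq G -> seq G' -> Prop) b k : ksupp Q k ->
  wsupp (fun s => Q s (val b)) (bicol b k).
Proof.
apply: supp_additive => -[a b'] /= Qab; rewrite /= /bicol linU /=.
by case: eqP => [<-|_]; [exact: suppU | exact: supp0].
Qed.

Lemma wsupp_row (Q : seq G -> seq G' -> Prop) a k : ksupp Q k ->
  wsupp (fun t => Q (val a) t) (birow a k).
Proof.
apply: supp_additive => -[a' b] /= Qab; rewrite /= /birow linU /=.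
by case: eqP => [<-|_]; [exact: suppU | exact: supp0].
Qed.

Lemma col_dh b k : bicol b (dh k) = wbd (bicol b k).
Proof.
elim/freeg_ind: k => [|k k' kE k'E|[a b']].
- by rewrite !raddf0.
- by rewrite !raddfB /= kE k'E.
by rewrite -tensU dh_tens !col_tens; case: eqP => // _; rewrite raddf0.
Qed.

Lemma row_dv a k : birow a (dv k) = (-1) ^+ size (val a) *: wbd (birow a k).
Proof.
elim/freeg_ind: k => [|k k' kE k'E|[a' b]].
- by rewrite !raddf0.
- by rewrite !raddfB /= kE k'E.
rewrite -tensU dv_tens -sym_val wsgn_sym tensZl raddfZint /= sym_val !row_tens.
by case: eqP => [-> //|_]; rewrite !raddf0.
Qed.

(** The right-hand side is id tensor F applied to [k]. Since [sum_row] has the same one, a property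
    of F known on rows can be used in a sum over columns. *)
Lemma sum_col (F : {additive wchain G' -> wchain G'}) (bs : seq (word G')) k :
  uniq bs -> supp (fun ab => ab.2 \in bs) k ->
  \sum_(b <- bs) tens (bicol b k) (F << b >>) = lin (fun ab => tens << ab.1 >> (F << ab.2 >>)) k.
Proof.
move=> ubs; move: k; apply: supp_ind => [|k k' kE k'E|[a b'] /= b'bs].
- by rewrite raddf0 big1 // => b _; rewrite raddf0 tens0l.
- by rewrite [RHS]raddfB /= -kE -k'E -sumrB; apply: eq_bigr => b _; rewrite raddfB tensBl.
rewrite linU /= (bigD1_seq b') //= -tensU col_tens eqxx big1 ?addr0 // => b.
by rewrite col_tens eq_sym => /negbTE ->; rewrite tens0l.
Qed.

Lemma sum_row (F : {additive wchain G' -> wchain G'}) (aa : seq (word G)) k :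
  uniq aa -> supp (fun ab => ab.1 \in aa) k ->
  \sum_(a <- aa) tens << a >> (F (birow a k)) = lin (fun ab => tens << ab.1 >> (F << ab.2 >>)) k.
Proof.
move=> uaa; move: k; apply: supp_ind => [|k k' kE k'E|[a' b] /= a'aa].
- by rewrite raddf0 big1 // => a _; rewrite !raddf0.
- by rewrite [RHS]raddfB /= -kE -k'E -sumrB; apply: eq_bigr => a _; rewrite !raddfB.
rewrite linU /= (bigD1_seq a') //= -tensU row_tens eqxx big1 ?addr0 // => a.
by rewrite row_tens eq_sym => /negbTE ->; rewrite !raddf0.
Qed.

End Bicomplex.

(** * The Künneth argument on one side *)

Section Kunneth.
Local Open Scope ring_scope.
Variables (G G' : groupType) (M : set G) (M' : set G').
Implicit Types (k z : bichain G G').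

Definition in_right (s : seq G) (t : seq G') := word_in M' t.
Definition in_both (s : seq G) (t : seq G') := word_in M s /\ word_in M' t.

(** The group of Omega(G', M') in degree [n], inside the chains of mixed degree. *)
Definition omega_deg n (v : wchain G') :=
  wsupp (fun t => size t = n /\ word_in M' t) v /\ wsupp (word_in M') (wbd v).

(** Omega is pure because a nonzero integer factor changes neither the support of a chain nor that
    of its boundary. *)
Lemma omega_deg_retraction n (vs : seq (wchain G')) :
  (forall v, v \in vs -> omega_deg n v) ->
  exists rho : {additive wchain G' -> wchain G'},
    (forall v, omega_deg n (rho v)) /\ (forall v, v \in vs -> rho v = v).
Proof.
apply: pure_retraction.
- by split; rewrite ?raddf0; apply: wsupp0.
- by move=> x y [xM dxM] [yM dyM]; split; rewrite ?raddfB; apply: wsuppB.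
move=> m x m0 [mxM dmxM]; have nz c : c != 0 -> m * c != 0.
  by move=> c0; rewrite mulf_neq0.
split; split=> s /nz.
  by rewrite -coeffZ => /(suppP mxM).
by rewrite -coeffZ -raddfZint => /(suppP dmxM).
Qed.

Lemma ksupp_dh (Q : seq G' -> Prop) k :
  ksupp (fun _ t => Q t) k -> ksupp (fun _ t => Q t) (dh k).
Proof.
move: k; apply: ksupp_ind => [|k k' kE k'E|s t _ _ Qt].
- by rewrite raddf0; apply: ksupp0.
- by rewrite raddfB; apply: ksuppB.
rewrite dh_tens; apply: ksupp_tens (wsuppT _) (wsupp_sym (Q := Q) _) => // s' t' _; exact.
Qed.

Lemma wsupp_wbd_size (P : groupType) n (v : wchain P) :
  wsupp (fun t => (size t < n.+1)%N) v -> wsupp (fun t => (size t < n)%N) (wbd v).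
Proof.
apply: wsupp_hom => t _ tn; rewrite /= wbd_sym.
case: t tn (wsupp_bd_word t) => [|x t] tn bdt; first exact: wsupp0.
by apply: sub_wsupp bdt => t' ->.
Qed.

Lemma ksupp_trunc (Q : seq G' -> Prop) n k :
  ksupp (fun _ t => (size t < n.+1)%N /\ Q t) k ->
  ksupp (fun _ t => (size t < n)%N /\ Q t)
    (k - lin (fun ab => tens << ab.1 >> (wproj n << ab.2 >>)) k).
Proof.
move: k; apply: (supp_additive (F := idfun \- lin _)) => -[a b] /= [bn Qb].
rewrite linU -tensU -tensBr -(sym_val b) wproj_sym sym_val.
apply: (@ksupp_tens G G' (fun=> True) (fun t => (size t < n)%N /\ Q t)
  (fun _ t => (size t < n)%N /\ Q t)) => //.
case: eqP => [_|bn']; first by rewrite subrr; apply: wsupp0.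
by rewrite subr0; apply: suppU; split=> //; rewrite ltn_neqAle -ltnS bn andbT; apply/eqP.
Qed.

Lemma ksupp_dv_size n k : ksupp (fun _ t => (size t < n.+1)%N) k ->
  ksupp (fun _ t => (size t < n)%N) (dv k).
Proof.
move: k; apply: ksupp_ind => [|k k' kE k'E|s t _ _ tn].
- by rewrite raddf0; apply: ksupp0.
- by rewrite raddfB; apply: ksuppB.
rewrite dv_tens; apply: (ksupp_tens (R := fun t => (size t < n)%N)) => //; first exact: wsuppT.
by apply/wsupp_wbd_size/wsupp_sym.
Qed.

Lemma ksupp_dv_word_in k : ksupp in_both (kbd k) -> ksupp in_right k -> ksupp in_right (dv k).
Proof.
move=> dkM kM; have -> : dv k = kbd k - dh k by rewrite /kbd /=; chain_ring.
by apply: ksuppB; [apply: sub_ksupp dkM => s t [] | apply: ksupp_dh].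
Qed.

(** Up to sign, the boundary of a row of [k] is a row of [dv k]. *)
Lemma omega_deg_row n a k : ksupp in_right k -> ksupp in_right (dv k) ->
  omega_deg n (wproj n (birow a k)).
Proof.
move=> kM dkM; split; first exact: wsupp_wproj (wsupp_row a kM).
case: n => [|n].
  rewrite (_ : wbd _ = 0); first exact: wsupp0.
  have := @wsupp_wproj G' 0 _ _ (wsuppT (birow a k)); move: (wproj _ _).
  apply: (eq_additive_wsupp (F1 := @wbd G') (F2 := \0)) => t _ [t0 _] /=.
  by rewrite wbd_sym (size0nil t0).
have dM : wsupp (word_in M') (wbd (birow a k)).
  have := wsupp_row a dkM; rewrite row_dv => /(wsuppZ ((-1) ^+ size (val a))).
  by rewrite scalerA -expr2 sqrr_sign scale1r.
rewrite wbd_wproj; apply: sub_wsupp (@wsupp_wproj G' n _ _ dM) => t; by case.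
Qed.

(** Since [dv] lowers the right degree, [dh k] and [kbd k] agree over right words of the top degree
    [n]. *)
Lemma col_cycle n b k : ksupp (fun _ t => (size t < n.+1)%N) k -> size (val b) = n ->
  ksupp in_both (kbd k) -> wsupp (word_in M) (wbd (bicol b k)).
Proof.
move=> kn bn dkM; rewrite -col_dh.
have -> : bicol b (dh k) = bicol b (kbd k) - bicol b (dv k).
  by rewrite /kbd raddfD /=; chain_ring.
apply: wsuppB; first by apply: sub_wsupp (wsupp_col b dkM) => s [].
by apply: sub_wsupp (wsupp_col b (ksupp_dv_size kn)) => s; rewrite /= bn ltnn.
Qed.

(** With the right words already in [M'], the left words are brought into [M], by induction on a
    bound for the right degree. The top columns can be corrected by acyclicity, but a single right
    word need not lie in Omega, so the corrections are paired with retractions of words into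
    Omega. *)
Lemma kunneth_left n k : relatively_acyclic M ->
    ksupp (fun _ t => (size t < n)%N) k -> ksupp in_right k -> ksupp in_both (kbd k) ->
  exists z, ksupp in_both (k - kbd z).
Proof.
move=> RA; elim: n k => [|n IHn] k kn kM dkM.
  exists 0; rewrite raddf0 subr0; apply: sub_ksupp kn => s t; by rewrite ltn0.
have dvM := ksupp_dv_word_in dkM kM.
have uE b : exists u, size (val b) = n -> wsupp (word_in M) (bicol b k - wbd u).
  have [bn|bn] := eqVneq (size (val b)) n; last by exists 0 => /eqP; rewrite (negbTE bn).
  by have [u uM] := RA _ (col_cycle kn bn dkM); exists u.
have [u uM] := choice uE.
pose aa := undup [seq ab.1 | ab <- dom k]; pose bb := undup [seq ab.2 | ab <- dom k].
have kaa : supp (fun ab => ab.1 \in aa) k.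
  by apply: sub_supp (supp_dom k) => ab abk; rewrite mem_undup; apply: map_f.
have kbb : supp (fun ab => ab.2 \in bb) k.
  by apply: sub_supp (supp_dom k) => ab abk; rewrite mem_undup; apply: map_f.
(* Only finitely many rows of [k] are nonzero, and their top parts lie in Omega, so one retraction
   fixes them all. *)
have [|rho [rhoM rhoK]] := @omega_deg_retraction n [seq wproj n (birow a k) | a <- aa].
  by move=> v /mapP[a _ ->]; apply: omega_deg_row.
have [F FE] : exists F : {additive wchain G' -> wchain G'}, forall v, F v = rho (wproj n v).
  by exists (rho \o wproj n).
have FM v : omega_deg n (F v) by rewrite FE; apply: rhoM.
have F0 b : size (val b) != n -> F << b >> = 0.
  by move=> bn; rewrite FE -sym_val wproj_sym (negbTE bn) raddf0.
pose z := \sum_(b <- bb) tens (u b) (F << b >>).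
pose m := \sum_(b <- bb) tens (bicol b k - wbd (u b)) (F << b >>).
pose kn' := lin (fun ab => tens << ab.1 >> (wproj n << ab.2 >>)) k : bichain G G'.
(* The columns tensored with [F << b >>] sum to id tensor F applied to [k]. Over rows, F reduces to
   taking the top part, because [rho] fixes it; so the sum is the top part of [k]. *)
have mE : m + dh z = kn'.
  rewrite /m /z raddf_sum -big_split /=.
  under eq_bigr => b _ do rewrite dh_tens tensBl subrK.
  rewrite (sum_col F (undup_uniq _) kbb) -(sum_row F (undup_uniq _) kaa).
  rewrite /kn' -(sum_row (wproj n) (undup_uniq _) kaa) big_seq [RHS]big_seq.
  by apply: eq_bigr => a aaa; rewrite FE rhoK //; apply: map_f.
have mM : ksupp in_both m.
  apply: ksupp_sum => b _; have [bn|/F0->] := eqVneq (size (val b)) n.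
    by apply: ksupp_tens (uM b bn) (proj1 (FM _)) => s t sM [].
  by rewrite tens0r; apply: ksupp0.
(* Here the values of F must lie in Omega and not merely be supported on words in [M']: their
   boundaries occur as well. *)
have dmM : ksupp in_both (kbd m).
  rewrite raddf_sum; apply: ksupp_sum => b _ /=; have [bn|/F0->] := eqVneq (size (val b)) n.
    rewrite kbd_tens; apply: ksuppD.
      apply: ksupp_tens _ (proj1 (FM _)); first by move=> s t sM []; split; [exact: sM|].
      by rewrite raddfB /= wbdK subr0; apply: col_cycle kn bn dkM.
    by apply: ksupp_tens (wsupp_wsgn (uM b bn)) (proj2 (FM _)) => s t.
  by rewrite tens0r raddf0; apply: ksupp0.
have knM : ksupp (fun s t => (size t < n)%N /\ word_in M' t) (k - kn').
  by apply/ksupp_trunc/ksuppI.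
have dvz : ksupp (fun s t => (size t < n)%N /\ word_in M' t) (dv z).
  rewrite raddf_sum; apply: ksupp_sum => b _ /=; rewrite dv_tens.
  have [FM1 FM2] := FM << b >>.
  have FM3 : wsupp (fun t => (size t < n)%N) (wbd (F << b >>)).
    by apply: wsupp_wbd_size; apply: sub_wsupp FM1 => t [-> _].
  by apply: ksupp_tens (wsuppT _) (wsuppI FM3 FM2).
(* The top part of [k] cancels, and what [dv z] adds has smaller right degree. *)
set k' := k - kbd z - m.
have k'E : k' = k - kn' - dv z by rewrite /k' -mE /kbd /=; chain_ring.
have [||| z' z'M] := IHn k'.
- by rewrite k'E; apply: ksuppB; [apply: sub_ksupp knM | apply: sub_ksupp dvz] => s t [].
- by rewrite k'E; apply: ksuppB; [apply: sub_ksupp knM | apply: sub_ksupp dvz] => s t [].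
- by rewrite /k' !raddfB /= kbdK subr0; apply: ksuppB.
exists (z + z'); have -> : k - kbd (z + z') = m + (k' - kbd z').
  by rewrite (raddfD (@kbd G G')) /= /k'; chain_ring.
exact: ksuppD.
Qed.

End Kunneth.

(** * Exchanging the two tensor factors *)

Section Swap.
Local Open Scope ring_scope.
Variables G G' : groupType.
Implicit Types (k : bichain G G').

(** The Koszul sign makes the exchange commute with [kbd]. *)
Definition biswap : bichain G G' -> bichain G' G :=
  klin (fun s t => (-1) ^+ (size s * size t) *: tens (sym t) (sym s)).
HB.instance Definition _ := GRing.Additive.on biswap.

Lemma swap_tens p q (x : wchain G) (y : wchain G') :
  wsupp (@deg_is G p) x -> wsupp (@deg_is G' q) y ->
  biswap (tens x y) = (-1) ^+ (p * q) *: tens y x.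
Proof.
move=> xp yq; move: x xp; apply: wsupp_ind => [|x x' xE x'E|s s1 sp].
- by rewrite tens0l tens0r raddf0 scaler0.
- by rewrite tensBl tensBr raddfB /= xE x'E scalerBr.
move: y yq; apply: wsupp_ind => [|y y' yE y'E|t t1 tq].
- by rewrite tens0l tens0r raddf0 scaler0.
- by rewrite tensBl tensBr raddfB /= yE y'E scalerBr.
by rewrite /biswap klin_tens // sp tq.
Qed.

Lemma ksupp_swap (Q : seq G -> seq G' -> Prop) k : ksupp Q k -> ksupp (fun t s => Q s t) (biswap k).
Proof.
move: k; apply: ksupp_ind => [|k k' kE k'E|s t s1 t1 Qst].
- by rewrite raddf0; apply: ksupp0.
- by rewrite raddfB; apply: ksuppB.
rewrite /biswap klin_tens //; apply: ksuppZ.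
by apply: (ksupp_tens (Q := eq t) (R := eq s)) => [t' s' <- <-||] //; apply: wsupp_sym.
Qed.

Lemma kbd_swap k : kbd (biswap k) = biswap (kbd k).
Proof.
elim/bichain_ind: k => [|k k' kE k'E|s t s1 t1]; first by rewrite !raddf0.
  by rewrite !raddfB /= kE k'E.
have sd (P : groupType) (r : seq P) : wsupp (@deg_is P (size r)) (sym r) by apply: wsupp_sym.
rewrite (swap_tens (sd _ s) (sd _ t)) raddfZint /= !kbd_tens (raddfD biswap) /= !wbd_sym.
rewrite (swap_tens (wsupp_bd_word s) (sd _ t)) !wsgn_sym !tensZl (raddfZint biswap) /=.
rewrite (swap_tens (sd _ s) (wsupp_bd_word t)) scalerDr !scalerA addrC.
congr (_ + _).
  case: s {s1} => [|a s]; first by rewrite /= tens0r !scaler0.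
  by rewrite /= mulSn addnC exprD -mulrA -expr2 sqrr_sign mulr1.
case: t {t1} => [|b t]; first by rewrite /= tens0l !scaler0.
by rewrite -exprD /= mulnS.
Qed.

End Swap.

Section KunnethTheorem.
Local Open Scope ring_scope.
Variables (G G' : groupType) (M : set G) (M' : set G').

Lemma swapK (k : bichain G G') : biswap (biswap k) = k.
Proof.
elim/bichain_ind: k => [|k k' kE k'E|s t s1 t1]; first by rewrite !raddf0.
  by rewrite !raddfB /= kE k'E.
have sd (P : groupType) (r : seq P) : wsupp (@deg_is P (size r)) (sym r) by apply: wsupp_sym.
rewrite (swap_tens (sd _ s) (sd _ t)) raddfZint /= (swap_tens (sd _ t) (sd _ s)).
by rewrite scalerA mulnC -expr2 sqrr_sign scale1r.
Qed.

Lemma ksupp_bounded (H H' : groupType) (k : bichain H H') :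
  exists n, ksupp (fun _ t => (size t < n)%N) k.
Proof.
elim/bichain_ind: k => [|k1 k2 [n1 E1] [n2 E2]|s t _ _].
- by exists 0%N; apply: ksupp0.
- exists (maxn n1 n2); apply: ksuppB.
    by apply: sub_ksupp E1 => s t tn; rewrite leq_max tn.
  by apply: sub_ksupp E2 => s t tn; rewrite leq_max tn orbT.
- by exists (size t).+1; apply: (ksupp_tens (Q := fun=> True) (R := eq t)) => [s' t' _ <-||] //; apply: wsupp_sym.
Qed.

Lemma kunneth (k : bichain G G') : relatively_acyclic M -> relatively_acyclic M' ->
  ksupp (in_both M M') (kbd k) -> exists z, ksupp (in_both M M') (k - kbd z).
Proof.
move=> RA RA' dkM.
have [n1 kn1] := ksupp_bounded (biswap k).
(* After the exchange, the one-sided result with the whole group [G] on the right brings the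
   [G']-words into [M']. This is the hypothesis needed to apply it again on the other side. *)
have [|| z1 z1M] := @kunneth_left G' G M' setT n1 (biswap k) RA' kn1.
- by apply: sub_ksupp kn1.
- by rewrite kbd_swap; apply: sub_ksupp (ksupp_swap dkM) => t s [sM tM]; split.
have kz : k - kbd (biswap z1) = biswap (biswap k - kbd z1).
  by rewrite raddfB /= swapK kbd_swap.
have [n2 kn2] := ksupp_bounded (k - kbd (biswap z1)).
have [|| z2 z2M] := @kunneth_left G G' M M' n2 _ RA kn2.
- by rewrite kz; apply: sub_ksupp (ksupp_swap z1M) => s t [].
- by rewrite raddfB /= kbdK subr0.
exists (biswap z1 + z2).
by rewrite (raddfD (@kbd G G')) /= opprD addrA.
Qed.

End KunnethTheorem.

(** * Shuffles *)

Section Shuffle.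
Local Open Scope ring_scope.
Variables G G' : groupType.
Local Notation P := (G * G')%type.
Implicit Types (a : G) (b : G') (s : seq G) (t : seq G') (x : wchain G) (y : wchain G').

Definition pairl a : P := (a, 1%g).
Definition pairr b : P := (1%g, b).

Lemma pairl1 : pairl 1%g = 1%g. Proof. by []. Qed.
Lemma pairr1 : pairr 1%g = 1%g. Proof. by []. Qed.
Lemma pairlM : {morph pairl : a a' / (a * a')%g}.
Proof. by move=> a a'; congr (_, _); rewrite mulg1. Qed.
Lemma pairrM : {morph pairr : b b' / (b * b')%g}.
Proof. by move=> b b'; congr (_, _); rewrite mulg1. Qed.
Lemma mul_pairlr a b : (pairl a * pairr b)%g = (a, b).
Proof. by congr (_, _); rewrite ?mulg1 ?mul1g. Qed.
Lemma mul_pairrl a b : (pairr b * pairl a)%g = (a, b).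
Proof. by congr (_, _); rewrite ?mulg1 ?mul1g. Qed.

(** The signed sum over all shuffles of [s] and [t]; a letter [b] put first has passed all of [s],
    hence the sign. The recursion shortens either word, hence the inner fixpoint. *)
Fixpoint shuffle_word s : seq G' -> wchain P :=
  if s is a :: s' then
    fix shuffle_s t := if t is b :: t' then
        wcons (pairl a) (shuffle_word s' t)
        + (-1) ^+ size s *: wcons (pairr b) (shuffle_s t')
      else sym (map pairl s)
  else fun t => sym (map pairr t).

Lemma shuffle_word_cons a s b t : shuffle_word (a :: s) (b :: t) =
  wcons (pairl a) (shuffle_word s (b :: t))
  + (-1) ^+ (size s).+1 *: wcons (pairr b) (shuffle_word (a :: s) t).
Proof. by []. Qed.

Lemma shuffle_word0r s : shuffle_word s [::] = sym (map pairl s).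
Proof. by case: s. Qed.

Lemma shuffle_word_degl s t : 1%g \in s -> shuffle_word s t = 0.
Proof.
elim: s t => // a s IHs t as1; elim: t => [|b t IHt].
  by rewrite shuffle_word0r sym0 // -pairl1 map_f.
rewrite shuffle_word_cons IHt raddf0 scaler0 addr0.
by move: as1; rewrite inE => /predU1P[<-|/IHs->]; rewrite ?pairl1 ?wcons1 ?raddf0.
Qed.

Lemma shuffle_word_degr s t : 1%g \in t -> shuffle_word s t = 0.
Proof.
elim: s t => [|a s IHs] t; first by move=> t1; rewrite /= sym0 // -pairr1 map_f.
elim: t => // b t IHt bt1; rewrite shuffle_word_cons IHs // raddf0 add0r.
by move: bt1; rewrite inE => /predU1P[<-|/IHt->]; rewrite ?pairr1 ?wcons1 !raddf0.
Qed.

Definition shuffle : bichain G G' -> wchain P := klin shuffle_word.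
HB.instance Definition _ := GRing.Additive.on shuffle.
Local Notation "x # y" := (shuffle (tens x y)) (at level 40).

Lemma shuffle_sym s t : sym s # sym t = shuffle_word s t.
Proof.
have [s1|s1] := boolP (1%g \in s).
  by rewrite sym0 // tens0l raddf0 shuffle_word_degl.
have [t1|t1] := boolP (1%g \in t).
  by rewrite (sym0 t1) tens0r raddf0 shuffle_word_degr.
by rewrite /shuffle klin_tens.
Qed.

Lemma shuffle0l y : sym [::] # y = wmap pairr y.
Proof.
elim/wchain_ind: y => [|y y' yE y'E|t _]; first by rewrite !raddf0.
  by rewrite tensBr !raddfB /= yE y'E.
by rewrite shuffle_sym wmap_sym.
Qed.

Lemma shuffle0r x : x # sym [::] = wmap pairl x.
Proof.
elim/wchain_ind: x => [|x x' xE x'E|s _]; first by rewrite tens0l !raddf0.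
  by rewrite tensBl !raddfB /= xE x'E.
by rewrite shuffle_sym shuffle_word0r wmap_sym.
Qed.

(** The sign depends on the degree of [x], so [x] must be homogeneous, while [y] is arbitrary. *)
Lemma shuffle_wcons n a x b y : wsupp (@deg_is G n) x ->
  wcons a x # wcons b y = wcons (pairl a) (x # wcons b y)
    + (-1) ^+ n.+1 *: wcons (pairr b) (wcons a x # y).
Proof.
move: x; apply: wsupp_ind => [|x x' xE x'E|s _ sn].
- by rewrite raddf0 !tens0l !raddf0 addr0.
- by rewrite raddfB !tensBl !raddfB /= xE x'E; chain_ring.
elim/wchain_ind: y => [|y y' yE y'E|t _]; first by rewrite raddf0 !tens0r !raddf0 addr0.
  by rewrite (raddfB (wcons b)) !tensBr !(raddfB shuffle) /= yE y'E !(raddfB (wcons _)); chain_ring.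
by rewrite !wcons_sym !shuffle_sym shuffle_word_cons sn.
Qed.

(* What remains of the Leibniz rule for the words a :: s and b :: t after the
   zeroth faces have been cancelled. *)
Definition beta_shuffle a s b t : Prop :=
  beta (pairl a) (sym s # wcons b (sym t))
    + (-1) ^+ (size s).+1 *: beta (pairr b) (wcons a (sym s) # sym t)
  = beta a (sym s) # wcons b (sym t) + (-1) ^+ (size s).+1 *: (wcons a (sym s) # beta b (sym t)).

Lemma wsupp_beta a s : wsupp (@deg_is G (size s)) (beta a (sym s)).
Proof. by rewrite beta_sym; apply: wsupp_beta_word. Qed.

Lemma sym_deg s : wsupp (@deg_is G (size s)) (sym s).
Proof. exact: wsupp_sym. Qed.

(** The right side is, up to sign, that of [beta_shuffle_right], and with the signs of
    [beta_shuffle] the two cancel. In particular the merged entry [(a, b)] arises once from [a]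
    before [b] and once from [b] before [a]. *)
Lemma beta_shuffle_left a s b t :
    (forall a' s', s = a' :: s' -> beta_shuffle a' s' b t) ->
  beta (pairl a) (sym s # wcons b (sym t)) - beta a (sym s) # wcons b (sym t) =
  (-1) ^+ size s *: (wcons (a, b) (sym s # sym t) - wcons (pairl a) (sym s # beta b (sym t))
     - wcons (pairr b) (beta a (sym s) # sym t)).
Proof.
case: s => [_|a' s /(_ _ _ erefl) IH].
  rewrite beta_sym /= !shuffle0l wmap_wcons // beta_wcons mul_pairrl scale1r.
  have -> : beta (pairr b) (wmap pairr (sym t)) = wmap pairr (beta b (sym t)).
    by rewrite wmap_sym // !beta_sym wmap_beta_word //; apply: pairrM.
  chain_ring.
rewrite /= -[sym (a' :: s)]wcons_sym beta_wcons !tensBl !(raddfB shuffle) /=.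
rewrite !(shuffle_wcons _ _ _ (sym_deg s)) (shuffle_wcons _ _ _ (wsupp_beta a' s)).
have := IH; rewrite /beta_shuffle; set X := _ # wcons b _; set Y := shuffle _.
set U := shuffle (tens (beta a' _) (wcons b _)); set V := shuffle (tens _ (beta b _)).
set C := shuffle (tens (wcons (_ * _)%g _) _); set D := shuffle (tens (wcons a _) _).
set e := (-1) ^+ _ => IHe.
have XE : beta (pairl a') X = U + e *: V - e *: beta (pairr b) Y by rewrite -IHe; chain_ring.
rewrite (raddfD (beta _)) (raddfZint (beta _)) /= !beta_wcons -pairlM mul_pairrl XE.
rewrite !(raddfB (wcons _)) /= !(raddfD (wcons _)) /= !(raddfZint (wcons _)) /=; chain_ring.
Qed.

Lemma beta_shuffle_right a s b t :
    (forall b' t', t = b' :: t' -> beta_shuffle a s b' t') ->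
  beta (pairr b) (wcons a (sym s) # sym t) - wcons a (sym s) # beta b (sym t) =
  wcons (a, b) (sym s # sym t) - wcons (pairr b) (beta a (sym s) # sym t)
  - wcons (pairl a) (sym s # beta b (sym t)).
Proof.
case: t => [_|b' t /(_ _ _ erefl) IH].
  rewrite (beta_sym b) /= !shuffle0r wmap_wcons // beta_wcons mul_pairlr.
  have -> : beta (pairl a) (wmap pairl (sym s)) = wmap pairl (beta a (sym s)).
    by rewrite wmap_sym // !beta_sym wmap_beta_word //; apply: pairlM.
  chain_ring.
rewrite /= -[sym (b' :: t)]wcons_sym (beta_wcons b) !tensBr !(raddfB shuffle) /=.
rewrite !(shuffle_wcons _ _ _ (sym_deg s)).
have := IH; rewrite /beta_shuffle; set X := _ # wcons b' _; set Y := _ # sym t.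
set U := shuffle (tens (beta a _) _); set V := shuffle (tens (wcons a _) (beta b' _)).
set C := shuffle (tens _ (wcons (_ * _)%g _)); set D := shuffle (tens _ (wcons b (beta _ _))).
set e := (-1) ^+ _ => IHe.
have XE : beta (pairl a) X = U + e *: V - e *: beta (pairr b') Y by rewrite -IHe; chain_ring.
rewrite (raddfD (beta _)) (raddfZint (beta _)) /= !beta_wcons -pairrM mul_pairlr XE.
rewrite !(raddfB (wcons _)) /= !(raddfD (wcons _)) /= !(raddfZint (wcons _)) /=; chain_ring.
Qed.

Lemma beta_shuffleP a s b t : beta_shuffle a s b t.
Proof.
have [n] := ubnP (size s + size t); elim: n a s b t => // n IHn a s b t stn.
have L a' s' : s = a' :: s' -> beta_shuffle a' s' b t by move=> sE; apply: IHn; move: stn; rewrite sE.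
have R b' t' : t = b' :: t' -> beta_shuffle a s b' t'.
  by move=> tE; apply: IHn; move: stn; rewrite tE /=; lia.
move/eqP: (beta_shuffle_left a L); rewrite subr_eq /beta_shuffle => /eqP ->.
move/eqP: (beta_shuffle_right b R); rewrite subr_eq => /eqP ->.
rewrite exprS mulN1r; chain_ring.
Qed.

Lemma wbd_shuffle k : wbd (shuffle k) = shuffle (kbd k).
Proof.
elim/bichain_ind: k => [|k k' kE k'E|s t _ _]; first by rewrite !raddf0.
  by rewrite !raddfB /= kE k'E.
rewrite kbd_tens (raddfD shuffle) /=.
case: s => [|a s].
  rewrite wsgn_sym scale1r (wbd_sym [::]) tens0l raddf0 add0r !shuffle0l.
  by rewrite wbd_wmap //; apply: pairrM.
case: t => [|b t].
  rewrite (wbd_sym [::]) tens0r raddf0 addr0 !shuffle0r.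
  by rewrite wbd_wmap //; apply: pairlM.
rewrite wsgn_sym -[sym (b :: t)]wcons_sym -[sym (a :: s)]wcons_sym.
rewrite (shuffle_wcons _ _ _ (sym_deg s)) raddfD (raddfZint (@wbd P)) /= !wbd_wcons.
rewrite tensZl (raddfZint shuffle) /= tensBl tensBr !(raddfB shuffle) /=.
have := beta_shuffleP a s b t; rewrite /beta_shuffle.
set X := beta (pairl a) _; set Y := beta (pairr b) _; set U := _ # wcons b _; set V := wcons a _ # _.
set e := (-1) ^+ _ => XE; have -> : X = U + e *: V - e *: Y by rewrite -XE; chain_ring.
chain_ring.
Qed.

End Shuffle.

(** * Direct products *)

Section ProductWords.
Local Open Scope ring_scope.
Variables G G' : groupType.
Local Notation P := (G * G')%type.
Implicit Types (s : seq G) (t : seq G') (r : seq P) (u w x y z : P).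

(** The normal form of (a, b) is (a, 1) times (1, b), whose right factor is the earlier entry. So a
    bar from [G'] to [G] can be inserted, and critical words have their [G]-letters first. *)
Definition prod_split w : option (P * P) :=
  if (w.1 != 1%g) && (w.2 != 1%g) then Some (pairr G w.2, pairl G' w.1) else None.

Definition prod_red : rel P := fun x y => (x.1 == 1%g) && (y.2 == 1%g).

Lemma prod_neq1 w : (w != 1%g) = (w.1 != 1%g) || (w.2 != 1%g).
Proof. by case: w => a b; rewrite -negb_and. Qed.

Lemma prod_splitP w x u : prod_split w = Some (x, u) ->
  [/\ w.1 != 1%g, w.2 != 1%g, x = pairr G w.2 & u = pairl G' w.1].
Proof. by rewrite /prod_split; case: ifP => // /andP[w1 w2] [<- <-]. Qed.

Lemma prod_split_NoneP w : prod_split w = None -> w != 1%g ->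
  (w.1 == 1%g) = (w.2 != 1%g).
Proof. by rewrite prod_neq1 /prod_split; do 2!case: eqP. Qed.

Fixpoint count_right r : nat :=
  if r is w :: r' then ((w.2 != 1%g) + count_right r')%N else 0%N.

Fixpoint count_left r : nat :=
  if r is w :: r' then ((w.1 != 1%g) + count_left r')%N else 0%N.

(* The number of letters plus the number of pairs with a letter of G in an
   earlier entry than a letter of G'. *)
Fixpoint prod_weight r : nat :=
  if r is w :: r' then
    ((w.1 != 1%g) + (w.2 != 1%g) + (w.1 != 1%g) * count_right r' + prod_weight r')%N
  else 0%N.

Lemma count_right_cat r1 r2 : count_right (r1 ++ r2) = (count_right r1 + count_right r2)%N.
Proof. by elim: r1 => //= w r1 ->; rewrite addnA. Qed.

Lemma prod_weight_cat r1 r2 : prod_weight (r1 ++ r2) =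
  (prod_weight r1 + count_left r1 * count_right r2 + prod_weight r2)%N.
Proof. by elim: r1 => //= w r1 ->; rewrite count_right_cat; lia. Qed.

Lemma prod_weight_behead x r : x != 1%g -> (prod_weight r < prod_weight (x :: r))%N.
Proof. by rewrite prod_neq1 /=; case: (x.1 == 1%g); case: (x.2 == 1%g) => //= _; lia. Qed.

Lemma prod_weight_belast x r : x != 1%g -> (prod_weight r < prod_weight (rcons r x))%N.
Proof.
rewrite prod_neq1 -cats1 prod_weight_cat /=.
by case: (x.1 == 1%g); case: (x.2 == 1%g) => //= _; rewrite ?muln0 ?muln1 ?addn0; lia.
Qed.

Lemma prod_weight_red r1 x y r2 : prod_red x y ->
  prod_weight (r1 ++ (y * x)%g :: r2) = prod_weight (r1 ++ x :: y :: r2).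
Proof.
move=> /andP[/eqP x1 /eqP y2].
have E1 : (y.1 * x.1)%g = y.1 by rewrite x1 mulg1.
have E2 : (y.2 * x.2)%g = x.2 by rewrite y2 mul1g.
rewrite !prod_weight_cat /= E1 E2 x1 y2 !eqxx /=.
lia.
Qed.

(** Either two letters of the same factor merge, or a letter of [G] in [x] and one of [G'] in [y]
    come to lie in one entry and no longer count as a pair. *)
Lemma prod_weight_nred r1 x y r2 : x != 1%g -> y != 1%g -> ~~ prod_red x y ->
  (prod_weight (r1 ++ (y * x)%g :: r2) < prod_weight (r1 ++ x :: y :: r2))%N.
Proof.
rewrite !prod_neq1 /prod_red => x1 y1 nxy.
have H1 : (((y.1 * x.1)%g != 1%g) <= (x.1 != 1%g) + (y.1 != 1%g))%N.
  by case: (eqVneq x.1) => [->|_]; [rewrite mulg1 | case: eqP].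
have H2 : (((y.2 * x.2)%g != 1%g) <= (x.2 != 1%g) + (y.2 != 1%g))%N.
  by case: (eqVneq x.2) => [->|_]; [rewrite mulg1 | case: eqP].
rewrite !prod_weight_cat /=.
move: x1 y1 nxy H1 H2; case: (x.1 == 1%g); case: (x.2 == 1%g); case: (y.1 == 1%g);
  case: (y.2 == 1%g); case: ((y.1 * x.1)%g == 1%g); case: ((y.2 * x.2)%g == 1%g) => //= *; lia.
Qed.

Definition lefts r : seq G := [seq w.1 | w <- r & w.1 != 1%g].
Definition rights r : seq G' := [seq w.2 | w <- r & w.2 != 1%g].
Local Notation crit := (critical prod_split prod_red).
Local Notation glue s t := (map (@pairl G G') s ++ map (@pairr G G') t).

Lemma prod_atomE w : prod_split w = None -> w != 1%g ->
  w = pairl G' w.1 /\ w.1 != 1%g \/ w = pairr G w.2 /\ w.2 != 1%g.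
Proof.
move=> wa w1; have E := prod_split_NoneP wa w1.
have [/eqP a1|a1] := boolP (w.1 == 1%g).
  by right; rewrite -E a1 eqxx {1}[w]surjective_pairing a1.
have /eqP b1 : w.2 == 1%g by apply: contraNT a1; rewrite E.
by left; rewrite {1}[w]surjective_pairing b1.
Qed.

Lemma critical_right b r : 1%g \notin r -> b != 1%g -> crit (pairr G b :: r) ->
  all (fun w => w.1 == 1%g) r.
Proof.
elim: r b => //= w r IHr b; rewrite word_cons => /andP[w1 r1] b1.
rewrite /prod_red /= eqxx /= => /and3P[_ w2 /and3P[/eqP wa wr cr]].
have wE : w = pairr G w.2.
  by case: (prod_atomE wa w1) => -[wE _] //; rewrite wE eqxx in w2.
by rewrite wE eqxx /=; apply: (IHr w.2); rewrite // -wE /= wa wr.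
Qed.

Lemma critical_pairr t : 1%g \notin t -> crit (map (@pairr G G') t).
Proof.
elim: t => // b t IHt; rewrite word_cons => /andP[b1 t1] /=; rewrite IHt // andbT.
rewrite /prod_split /= eqxx /=; case: t t1 {IHt} => //= b' t.
by rewrite word_cons /prod_red /= eqxx => /andP[].
Qed.

Lemma critical_glue s t : 1%g \notin s -> 1%g \notin t -> crit (glue s t).
Proof.
move=> + t1; elim: s => [_|a s IHs]; first exact: critical_pairr.
rewrite word_cons => /andP[a1 s1] /=; rewrite IHs // andbT.
rewrite /prod_split /= eqxx andbF /=; case: (_ ++ _) => //= w r.
by rewrite /prod_red /= (negPf a1).
Qed.

Lemma critical_glueE r : 1%g \notin r -> crit r -> r = glue (lefts r) (rights r).
Proof.
elim: r => // w r IHr wr1 cwr; have := wr1; rewrite word_cons => /andP[w1 r1].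
have /and3P[/eqP wa _ cr] := cwr.
rewrite {1}(IHr r1 cr) /lefts /rights /=.
case: (prod_atomE wa w1) => -[wE nw].
  by rewrite nw {1}wE wE eqxx.
rewrite nw; have w11 : w.1 == 1%g by rewrite wE.
rewrite w11 /=; have /allP r11 := critical_right r1 nw (eq_ind w (fun w => crit (w :: r)) cwr _ wE).
have -> : [seq w0.1 | w0 <- r & w0.1 != 1%g] = [::].
  apply/eqP; rewrite -size_eq0 size_map size_filter -leqn0 leqNgt -has_count.
  by apply/hasPn => z /r11; rewrite negbK.
by rewrite /= -wE.
Qed.

Lemma lefts_glue s t : 1%g \notin s -> lefts (glue s t) = s.
Proof.
move=> s1; rewrite /lefts filter_cat map_cat -[RHS]cats0; congr (_ ++ _); last first.
  by elim: t => //= b t IHt; rewrite eqxx.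
elim: s s1 => //= a s IHs; rewrite word_cons => /andP[-> /IHs].
by rewrite /= => ->.
Qed.

Lemma rights_glue s t : 1%g \notin t -> rights (glue s t) = t.
Proof.
move=> t1; rewrite /rights filter_cat map_cat -[RHS]cat0s; congr (_ ++ _).
  by elim: s => //= a s IHs; rewrite eqxx.
elim: t t1 => //= b t IHt; rewrite word_cons => /andP[-> /IHt].
by rewrite /= => ->.
Qed.

Lemma prod_weight_glue s t : 1%g \notin s -> 1%g \notin t ->
  prod_weight (glue s t) = (size s + size t + size s * size t)%N.
Proof.
move=> s1 t1; rewrite prod_weight_cat.
have -> : count_right (map (@pairr G G') t) = size t.
  by elim: t t1 => //= b t IHt; rewrite word_cons => /andP[-> /IHt ->].
have -> : prod_weight (map (@pairr G G') t) = size t.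
  by elim: t t1 => //= b t IHt; rewrite word_cons eqxx => /andP[-> /IHt ->].
elim: s s1 => [_|a s IHs] /=; first by lia.
rewrite word_cons eqxx => /andP[-> /IHs] /=.
have -> : count_right (map (@pairl G G') s) = 0%N by elim: s {IHs} => //= a' s ->; rewrite eqxx.
lia.
Qed.

Definition shuffle_in s t r : Prop := forall w, w \in r ->
  (exists2 a, a \in s & w = pairl G' a) \/ (exists2 b, b \in t & w = pairr G b).

Lemma wsupp_shuffle_word (R : seq G -> seq G' -> seq P -> Prop) :
    (forall s, R s [::] (map (@pairl G G') s)) -> (forall t, R [::] t (map (@pairr G G') t)) ->
    (forall a s b t r, a != 1%g -> R s (b :: t) r -> R (a :: s) (b :: t) (pairl G' a :: r)) ->
    (forall a s b t r, b != 1%g -> R (a :: s) t r -> R (a :: s) (b :: t) (pairr G b :: r)) ->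
  forall s t, wsupp (R s t) (shuffle_word s t).
Proof.
move=> R0r R0l Rl Rr; elim=> [|a s IHs] t; first exact: wsupp_sym.
elim: t => [|b t IHt]; first by rewrite shuffle_word0r; apply: wsupp_sym.
rewrite shuffle_word_cons; apply: wsuppD; last apply: wsuppZ.
  apply: wsupp_wcons (IHs _) => r; rewrite word_cons => /andP[a1 _]; apply: Rl.
  by apply: contraNneq a1 => ->.
apply: wsupp_wcons IHt => r; rewrite word_cons => /andP[b1 _]; apply: Rr.
by apply: contraNneq b1 => ->.
Qed.

Lemma shuffle_letters s t : wsupp (shuffle_in s t) (shuffle_word s t).
Proof.
apply: (wsupp_shuffle_word (R := shuffle_in)) => {s t} [s w|t w|a s b t r _ rst w|a s b t r _ rst w].
- by move=> /mapP[a sa ->]; left; exists a.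
- by move=> /mapP[b tb ->]; right; exists b.
- rewrite inE => /predU1P[->|/rst[[a' sa' ->]|]]; last by right.
    by left; exists a; rewrite ?mem_head.
  by left; exists a'; rewrite // inE sa' orbT.
- rewrite inE => /predU1P[->|/rst[|[b' tb' ->]]]; last 1 first.
  + by right; exists b'; rewrite // inE tb' orbT.
  + by right; exists b; rewrite ?mem_head.
  + by left.
Qed.

Lemma shuffle_weight s t : 1%g \notin s -> 1%g \notin t ->
  wsupp (fun r => (prod_weight r <= prod_weight (glue s t))%N) (shuffle_word s t).
Proof.
move=> s1 t1; rewrite prod_weight_glue //.
(* The number of [G']-letters is carried along because a new letter of [G] in front forms a pair
   with each of them. *)
pose R s t r := 1%g \notin s -> 1%g \notin t -> count_right r = size t /\
  (prod_weight r <= size s + size t + size s * size t)%N.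
suff : wsupp (R s t) (shuffle_word s t) by apply: sub_wsupp => r /(_ s1 t1) [].
apply: wsupp_shuffle_word => {s t s1 t1} [s|t|a s b t r a1 IH|a s b t r b1 IH]; rewrite /R.
- move=> s1 _; split; first by elim: s {s1} => //= a s ->; rewrite eqxx.
  by have := prod_weight_glue s1 (isT : 1%g \notin [::]); rewrite cats0 => ->.
- move=> _ t1; split; first by elim: t t1 => //= b t IHt; rewrite word_cons => /andP[-> /IHt ->].
  by have := prod_weight_glue (isT : 1%g \notin [::]) t1 => /= ->.
- move=> as1 t1; move: as1; rewrite word_cons => /andP[_ s1]; have [cr wr] := IH s1 t1.
  by split; rewrite /= ?eqxx ?a1 //= cr; move: wr => /=; lia.
- move=> s1; rewrite word_cons => /andP[_ t1]; have [cr wr] := IH s1 t1.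
  by split; rewrite /= ?eqxx ?b1 //= ?cr //; move: wr => /=; lia.
Qed.

Lemma shuffle_leading s t : 1%g \notin s -> 1%g \notin t ->
  wsupp (fun r => ~~ crit r) (shuffle_word s t - sym (glue s t)).
Proof.
elim: s t => [|a s IHs] t; first by rewrite subrr => *; apply: wsupp0.
move=> as1; have := as1; rewrite word_cons => /andP[a1 s1].
case: t => [|b t] bt1; first by rewrite cats0 subrr; apply: wsupp0.
have := bt1; rewrite word_cons => /andP[b1 t1].
rewrite shuffle_word_cons map_cons cat_cons -(wcons_sym (pairl G' a)) addrAC -(raddfB (wcons (pairl G' a))).
apply: wsuppD; last apply: wsuppZ.
  by apply: wsupp_wcons (IHs _ s1 bt1) => r _; apply: contraNN => /and3P[].
(* If [b] comes first, the letter [a] still follows it, which is impossible in a critical word. *)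
have ha : wsupp (fun r => ~~ all (fun w => w.1 == 1%g) r) (shuffle_word (a :: s) t).
  pose R s t r := 1%g \notin s -> s != [::] -> ~~ all (fun w : P => w.1 == 1%g) r.
  suff : wsupp (R (a :: s) t) (shuffle_word (a :: s) t).
    by apply: sub_wsupp => r; apply.
  apply: wsupp_shuffle_word => [s2|//|a2 s2 b2 t2 r a1' _|a2 s2 b2 t2 r b1' IH]; rewrite /R.
  - by case: s2 => // a' s'; rewrite word_cons => /andP[a1' _] _ /=; rewrite (negPf a1').
  - by move=> _ _ /=; rewrite (negPf a1').
  - by rewrite /= eqxx.
apply: wsupp_wcons ha => r; rewrite word_cons => /andP[_ r1].
by apply: contraNN; apply: critical_right.
Qed.

End ProductWords.

(** * Relative acyclicity for the direct product *)

Section ProductAcyclic.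
Local Open Scope ring_scope.
Variables (G G' : groupType) (M : set G) (M' : set G').
Local Notation P := (G * G')%type.
Local Notation crit := (critical (@prod_split G G') (@prod_red G G')).

Lemma shuffle_atomic k : wsupp (atomic (@prod_split G G')) (shuffle k).
Proof.
elim/bichain_ind: k => [|k k' kE k'E|s t _ _]; first by rewrite raddf0; apply: wsupp0.
  by rewrite raddfB; apply: wsuppB.
rewrite shuffle_sym; apply: sub_wsupp (shuffle_letters s t) => r rst.
by apply/allP => w /rst[] [c _ ->]; rewrite /prod_split /= eqxx ?andbF.
Qed.

Lemma shuffle_wedge k : ksupp (in_both M M') k -> wsupp (word_in (wedge M M')) (shuffle k).
Proof.
move: k; apply: ksupp_ind => [|k k' kE k'E|s t _ _ [sM tM]]; first by rewrite raddf0; apply: wsupp0.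
  by rewrite raddfB; apply: wsuppB.
rewrite shuffle_sym; apply: sub_wsupp (shuffle_letters s t) => r rst w /rst[] [c cM ->].
  by left; split=> //; apply: sM.
by right; split=> //; apply: tM.
Qed.

(** A critical word is completed to the shuffle product of its halves: the boundary is again a
    combination of shuffles, whose entries each lie in one factor. *)
Lemma prod_morse (T : wchain P) : wsupp (atomic (@prod_split G G')) (wbd T) ->
  exists c z, wsupp crit c /\
    T = wlin (fun r => shuffle_word (lefts r) (rights r)) c + wbd z.
Proof.
move=> dT; have lefts1 r : 1%g \notin lefts r.
  by apply/mapP => -[w]; rewrite mem_filter => /andP[+ _] /esym/eqP => /negPf ->.
have rights1 r : 1%g \notin rights r.
  by apply/mapP => -[w]; rewrite mem_filter => /andP[+ _] /esym/eqP => /negPf ->.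
apply: (@morse _ (@prod_split G G') (@prod_red G G') (@prod_weight G G')) dT.
- move=> w x u /prod_splitP[w1 w2 -> ->]; split.
  + by rewrite prod_neq1 w2 orbT.
  + by rewrite prod_neq1 w1.
  + by rewrite mul_pairlr -surjective_pairing.
  + by rewrite /prod_split /= eqxx.
  + by rewrite /prod_red /= !eqxx.
- by move=> w x u y /prod_splitP[w1 w2 _ ->] _; rewrite /prod_red /= (negPf w1).
- by move=> w x u y /prod_splitP[w1 w2 _ _] _; rewrite /prod_red (negPf w1).
- move=> w y wa w1 y1 /andP[w11 y21]; have w2 := prod_split_NoneP wa w1.
  rewrite w11 in w2; have y11 : y.1 != 1%g by rewrite prod_neq1 y21 orbF in y1.
  have yw : (y * w)%g = (y.1, w.2).
    by rewrite -mul_pairlr; congr (_ * _)%g; [rewrite {1}[y]surjective_pairing (eqP y21) | rewrite {1}[w]surjective_pairing (eqP w11)].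
  rewrite yw /prod_split /= y11 -w2; congr (Some (_, _)).
    by rewrite {2}[w]surjective_pairing (eqP w11).
  by rewrite {2}[y]surjective_pairing (eqP y21).
- by move=> w y x u wa w1 /prod_splitP[y1 y2 -> _]; rewrite /prod_red /= (negPf y2) andbF.
- by move=> w y z wa w1 y1 z1 /andP[_ /eqP z2]; rewrite /prod_red -[(z * y)%g.2]/(z.2 * y.2)%g z2 mul1g.
- move=> x y x1 y1 /andP[/eqP x11 /eqP y2]; rewrite prod_neq1 -[(y * x)%g.1]/(y.1 * x.1)%g.
  by rewrite x11 mulg1; move: y1; rewrite prod_neq1 y2 eqxx orbF => ->.
- by move=> x r; apply: prod_weight_behead.
- by move=> x r; apply: prod_weight_belast.
- by move=> s x y r _ _; apply: prod_weight_red.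
- by move=> s x y r x1 y1 _; apply: prod_weight_nred.
- move=> r r1 cr; have rE := critical_glueE r1 cr.
  rewrite [in sym r]rE [in prod_weight r]rE -opprB.
  apply/wsuppN/wsuppI; first exact: shuffle_leading.
  by apply: wsuppB; [apply: shuffle_weight | apply: wsupp_sym].
- by move=> r _ _; rewrite -shuffle_sym wbd_shuffle; apply: shuffle_atomic.
Qed.

Definition critical_part : wchain P -> bichain G G' :=
  wlin (fun r => if crit r then tens (sym (lefts r)) (sym (rights r)) else 0).
HB.instance Definition _ := GRing.Additive.on critical_part.

Lemma shuffle_critical_part c : wsupp crit c ->
  shuffle (critical_part c) = wlin (fun r => shuffle_word (lefts r) (rights r)) c.
Proof.
move: c; apply: (eq_additive_wsupp (F1 := @shuffle G G' \o critical_part)) => r r1 cr.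
by rewrite /= /critical_part !wlin_word // cr shuffle_sym.
Qed.

(** A shuffle product has a single critical term, the unshuffled word with coefficient 1. So bounds
    on the support of a shuffle pass back to the bichain. *)
Lemma critical_partK k : critical_part (shuffle k) = k.
Proof.
elim/bichain_ind: k => [|k k' kE k'E|s t s1 t1]; first by rewrite !raddf0.
  by rewrite !raddfB /= kE k'E.
rewrite shuffle_sym -[shuffle_word s t](subrK (sym (map (@pairl G G') s ++ map (@pairr G G') t))).
rewrite raddfD /= (_ : critical_part (_ - _) = 0); last first.
  move: (shuffle_leading s1 t1); move: (_ - _).
  apply: (eq_additive_wsupp (F1 := critical_part) (F2 := \0)) => r r1 /negPf cr.
  by rewrite /= /critical_part wlin_word // cr.
have cg := critical_glue s1 t1.
have g1 : 1%g \notin map (@pairl G G') s ++ map (@pairr G G') t.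
  rewrite mem_cat negb_or; apply/andP; split.
    by apply/mapP => -[a sa [aE]]; rewrite aE sa in s1.
  by apply/mapP => -[b tb [bE]]; rewrite bE tb in t1.
by rewrite add0r /critical_part wlin_word // cg lefts_glue // rights_glue.
Qed.

Lemma ksupp_critical_part T : wsupp (word_in (wedge M M')) T ->
  ksupp (in_both M M') (critical_part T).
Proof.
apply: wsupp_additive => r r1 rM; rewrite /= /critical_part wlin_word //.
case: ifP => _; last exact: ksupp0.
apply: (ksupp_tens (S := in_both M M') (Q := word_in M) (R := word_in M')) => //.
  apply: wsupp_sym => _ a /mapP[w]; rewrite mem_filter => /andP[w1 wr] ->.
  by case: (rM _ wr) => [[//]|[/= wE _]]; rewrite wE eqxx in w1.
apply: wsupp_sym => _ b /mapP[w]; rewrite mem_filter => /andP[w2 wr] ->.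
by case: (rM _ wr) => [[_ /= wE]|[//]]; rewrite wE eqxx in w2.
Qed.

Lemma relatively_acyclic_wedge :
  relatively_acyclic M -> relatively_acyclic M' -> relatively_acyclic (wedge M M').
Proof.
move=> RA RA' T dTM; have [|c [z [cc TE]]] := prod_morse (T := T).
  apply: sub_wsupp dTM => r rM; apply/allP => -[a b] /rM[] [/=] => [_ ->|-> _];
    by rewrite /prod_split /= eqxx ?andbF.
rewrite -(shuffle_critical_part cc) in TE; set k := critical_part c in TE.
(* The boundary of [T] is the shuffle of [kbd k], so [kbd k] can be read off from its critical
   words. *)
have dkM : ksupp (in_both M M') (kbd k).
  rewrite -[kbd k]critical_partK -wbd_shuffle; apply: ksupp_critical_part.
  by move: dTM; rewrite TE raddfD /= wbdK addr0.
have [z' z'M] := kunneth RA RA' dkM.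
exists (z + shuffle z'); rewrite TE raddfD /= wbd_shuffle.
have -> : shuffle k + wbd z - (wbd z + shuffle (kbd z')) = shuffle (k - kbd z').
  by rewrite raddfB /=; chain_ring.
exact: shuffle_wedge.
Qed.

End ProductAcyclic.

Local Open Scope classical_set_scope.

Theorem proposition14p6 (G G' : groupType) (M : set G) (M' : set G') :
  coacyclic M -> coacyclic M' ->
  coacyclic (wedge M M') /\
  coacyclic ((@fp_inl G G' @` M) `|` (@fp_inr G G' @` M')).
Proof.
move=> /coacyclicP[M1 RA] /coacyclicP[M'1 RA']; split; apply/coacyclicP; split.
- by left.
- exact: relatively_acyclic_wedge.
- by left; exists 1%g => //; apply: fp_inl1.
- exact: relatively_acyclic_free_product.
Qed.
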